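(* In the open-loop linear-quadratic game described in the context, for every $u\in\mathcal U^{(N)}$ the open-loop $\alpha$-potential function $\Phi^{t,x}(u):=\int_0^1\sum_{i=1}^N\frac{\delta J_i^{t,x}}{\delta u_i}(ru;u_i)\,dr$ satisfies $$\Phi^{t,x}(u)=\mathbb E\left[\int_t^TF\big(s,X_s^u,Y_s^{1,u_1},\dots,Y_s^{N,u_N},u_s\big)\,ds+G\big(X_T^u,Y_T^{1,u_1},\dots,Y_T^{N,u_N}\big)\right],$$ where, for $y=(y_1,\dots,y_N)\in(\mathbb R^n)^N$, $\bar y=\sum_{i=1}^Ny_i$ and $a=(a_1^\top,\dots,a_N^\top)^\top$, $$F(t,x,y,a)=\sum_{i=1}^N\Big\{y_i^\top Q_i(t)\big(x-\tfrac12\bar y\big)+\tfrac12y_i^\top S_i(t)a+q_i(t)^\top y_i+(E_ia_i)^\top\big[\tfrac12R_i(t)a+S_i(t)^\top\big(x-\tfrac12\bar y\big)+\rho_i(t)\big]\Big\},$$ $$G(x,y)=\sum_{i=1}^N\Big[y_i^\top G_i\big(x-\tfrac12\bar y\big)+g_i^\top y_i\Big].$$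
   Context: **Setting.** $(\Omega,\mathcal F,\mathbb F,\mathbb P)$ is a complete filtered probability space satisfying the usual conditions with a $d_W$-dimensional Brownian motion $W=(W^1,\dots,W^{d_W})^\top$; $t\in[0,T]$ and $x\in\mathbb R^n$ are fixed. $\mathcal H^2([t,T];E)$ is the space of progressively measurable $E$-valued processes $v$ with $\mathbb E\int_t^T|v_s|^2ds<\infty$. Controls are $u=(u_1^\top,\dots,u_N^\top)^\top$, $u_i\in\mathbb R^{k_i}$, $k=\sum_ik_i$. $E_i\in\mathbb R^{k\times k_i}$ has $i$-th block the identity and other blocks zero. Each action set $A_i\subset\mathbb R^{k_i}$ is convex with $0\in A_i$. $\mathcal U_i$ is the set of progressively measurable $A_i$-valued $u_i\in\mathcal H^2([t,T];\mathbb R^{k_i})$; $\mathcal U^{(N)}=\prod_i\mathcal U_i$. State: $dX_s^u=(A_sX_s^u+B_su_s+b_s)ds+\sum_{h=1}^{d_W}(C_s^hX_s^u+D_s^hu_s+\sigma_s^h)dW_s^h$, $X_t^u=x$. Cost: $$J_i^{t,x}(u)=\tfrac12\mathbb E\Big[\int_t^T\big((X_s^u)^\top Q_iX_s^u+u_s^\top R_iu_s+2(X_s^u)^\top S_iu_s+2q_i^\top X_s^u+2\rho_i^\top u_s\big)ds+(X_T^u)^\top G_iX_T^u+2g_i^\top X_T^u\Big].$$ Coefficients: $A,C^h\in L^\infty(0,T;\mathbb R^{n\times n})$, $B,D^h\in L^\infty(0,T;\mathbb R^{n\times k})$, $b,\sigma^h\in L^2(0,T;\mathbb R^n)$, $Q_i\in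 L^\infty(0,T;\mathbb S^n)$, $R_i\in L^\infty(0,T;\mathbb S^k)$, $S_i\in L^\infty(0,T;\mathbb R^{n\times k})$, $q_i\in L^2(0,T;\mathbb R^n)$, $\rho_i\in L^2(0,T;\mathbb R^k)$, $G_i\in\mathbb S^n$, $g_i\in\mathbb R^n$ ($\mathbb S^n$: symmetric $n\times n$ matrices). **Variational processes.** With $B_i=BE_i$, $D_i^h=D^hE_i$, for $v_i\in\mathcal H^2([t,T];\mathbb R^{k_i})$ the process $Y^{i,v_i}$ solves $dY_s^{i,v_i}=(A_sY_s^{i,v_i}+B_i(s)v_{i,s})ds+\sum_{h=1}^{d_W}(C_s^hY_s^{i,v_i}+D_i^h(s)v_{i,s})dW_s^h$, $Y_t^{i,v_i}=0$. **Linear derivative.** $\frac{\delta J_i}{\delta u_i}:\mathcal U^{(N)}\times\operatorname{span}(\mathcal U_i)\to\mathbb R$ is linear in its second argument and satisfies $\lim_{\epsilon\downarrow0}\epsilon^{-1}[J_i(u_i+\epsilon(u_i'-u_i),u_{-i})-J_i(u)]=\frac{\delta J_i}{\delta u_i}(u;u_i'-u_i)$ for all $u\in\mathcal U^{(N)}$, $u_i'\in\mathcal U_i$. *)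

(* Defs.v *)
From HB Require Import structures.
From mathcomp Require Import all_boot all_order all_algebra.
From mathcomp Require Import all_classical all_reals all_analysis.

Set Implicit Arguments.
Unset Strict Implicit.
Unset Printing Implicit Defensive.

Import Order.TTheory GRing.Theory Num.Theory.
Import numFieldNormedType.Exports.

Local Open Scope classical_set_scope.
Local Open Scope ring_scope.

Definition dotmx (R : realType) (m : nat) (x y : 'cV[R]_m) : R :=
  (x^T *m y) 0 0.

Definition lin_span (R : realType) (V : lmodType R) (A : set V) : set V :=
  [set v | exists m (c : 'I_m -> R) (w : 'I_m -> V),
    (forall j, A (w j)) /\ v = \sum_j c j *: w j].

Section coefficient_spaces.
Context {R : realType}.
Implicit Types (T : R) (f : R -> R).

(* Representatives of the elements of L^oo(0,T) and L^2(0,T); the endpoints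
   form a null set. *)
Definition Linfty T f : Prop :=
  measurable_fun `[0, T] f /\
  exists M : R, {ae lebesgue_measure, forall s, s \in `[0, T] -> `|f s| <= M}.

Definition L2 T f : Prop :=
  measurable_fun `[0, T] f /\
  (\int[lebesgue_measure]_(s in `[0%R, T]) ((f s) ^+ 2)%:E < +oo)%E.

Definition Linfty_mx T (m n : nat) (A : R -> 'M[R]_(m, n)) : Prop :=
  forall i j, Linfty T (fun s => A s i j).

Definition L2_mx T (m n : nat) (A : R -> 'M[R]_(m, n)) : Prop :=
  forall i j, L2 T (fun s => A s i j).

End coefficient_spaces.

Section stochastic_basis.
Context {d : measure_display} {Omega : measurableType d} {R : realType}.
Variables (P : probability Omega R) (T : R) (Flt : R -> set (set Omega)).

(* Completeness of P itself is the library's [measure_is_complete]. *)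
Record usual_filtration : Prop := UsualFiltration {
  flt_sigma_algebra : forall s : R, s \in `[0, T] -> sigma_algebra setT (Flt s) ;
  flt_measurable : forall s : R, s \in `[0, T] -> Flt s `<=` measurable ;
  flt_mono : forall r s : R, 0 <= r -> r <= s -> s <= T -> Flt r `<=` Flt s ;
  flt_right_continuous : forall s : R, 0 <= s -> s < T ->
    \bigcap_(r in [set r | s < r <= T]) Flt r = Flt s ;
  flt_null : forall s : R, s \in `[0, T] -> P.-negligible `<=` Flt s
}.

Definition increment (B : R -> Omega -> R) (r s : R) (w : Omega) : R :=
  B s w - B r w.

Record brownian_motion (dW : nat) (W : 'I_dW -> R -> Omega -> R) : Prop :=
  BrownianMotion {
  bm_start : {ae P, forall w, forall h, W h 0 w = 0} ;
  bm_continuous : {ae P, forall w, forall h,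
    {within `[0, T], continuous (fun s => W h s w)}} ;
  bm_adapted : forall h (s : R), s \in `[0, T] ->
    measurable_fun [set: g_sigma_algebraType (Flt s)]
      (W h s : g_sigma_algebraType (Flt s) -> R) ;
  bm_normal : forall h (r s : R) (U : set R), 0 <= r -> r < s -> s <= T ->
    measurable U ->
    P (increment (W h) r s @^-1` U) =
      normal_prob 0 (Num.sqrt (s - r)) U ;
  (* Flt r and the dW coordinates of the increment over [r, s] are mutually
     independent. *)
  bm_independent : forall (r s : R) (A : set Omega) (U : 'I_dW -> set R),
    0 <= r -> r < s -> s <= T ->
    Flt r A -> (forall h, measurable (U h)) ->
    P (A `&` \bigcap_(h in [set: 'I_dW]) increment (W h) r s @^-1` U h) =
      (P A * \prod_(h < dW) P (increment (W h) r s @^-1` U h))%E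
}.

Definition process (m : nat) : Type := R -> Omega -> 'cV[R]_m.

HB.instance Definition _ (m : nat) := GRing.Lmodule.on (process m).

Definition progressive (t : R) (m : nat) (v : process m) : Prop :=
  forall s j, s \in `[t, T] ->
    measurable_fun (`[t, s] `*` setT)
      (fun p : measurableTypeR R * g_sigma_algebraType (Flt s) =>
         v p.1 p.2 j 0).

Definition H2 (t : R) (m : nat) (v : process m) : Prop :=
  progressive t v /\
  (\int[P]_w \int[lebesgue_measure]_(s in `[t, T])
     (\sum_(j < m) (v s w j 0) ^+ 2)%:E < +oo)%E.

(* The simple integrand \sum_(j < m) xi_j 1_(]tau_j, tau_(j+1)]) and its
   integral against a scalar path. *)
Definition simple_integrand (a b : R) (m : nat) (tau : nat -> R)
    (xi : nat -> Omega -> R) : Prop :=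
  [/\ a <= tau 0%N, tau m <= b,
      forall j, (j < m)%N -> tau j <= tau j.+1,
      forall j, (j < m)%N ->
        measurable_fun [set: g_sigma_algebraType (Flt (tau j))]
          (xi j : g_sigma_algebraType (Flt (tau j)) -> R) &
      exists M : R, forall j w, (j < m)%N -> `|xi j w| <= M].

Definition simple_process (m : nat) (tau : nat -> R) (xi : nat -> Omega -> R)
    (r : R) (w : Omega) : R :=
  \sum_(j < m) xi j w * (tau j < r <= tau j.+1)%R%:R.

Definition simple_integral (B : R -> Omega -> R) (m : nat) (tau : nat -> R)
    (xi : nat -> Omega -> R) (w : Omega) : R :=
  \sum_(j < m) xi j w * increment B (tau j) (tau j.+1) w.

(* I is a version of the Ito integral of H dB over [a, b]: the L^2(P)-limit of
   the integrals of simple integrands that converge to H in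
   L^2([a, b] * Omega). *)
Definition is_ito_integral (B : R -> Omega -> R) (a b : R)
    (H : R -> Omega -> R) (I : Omega -> R) : Prop :=
  measurable_fun setT I /\
  exists (m : nat -> nat) (tau : nat -> nat -> R)
      (xi : nat -> nat -> Omega -> R),
    [/\ forall l, simple_integrand a b (m l) (tau l) (xi l),
        (fun l => \int[P]_w \int[lebesgue_measure]_(r in `[a, b])
           ((simple_process (m l) (tau l) (xi l) r w - H r w) ^+ 2)%:E)%E
          @ \oo --> 0%E &
        (fun l => \int[P]_w
           ((simple_integral B (m l) (tau l) (xi l) w - I w) ^+ 2)%:E)%E
          @ \oo --> 0%E].

(* Z is a continuous square-integrable solution on [t, T] of
     dZ = f(s, Z) ds + \sum_h g^h(s, Z) dW^h,   Z_t = z. *)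
Definition solves_sde (dW : nat) (W : 'I_dW -> R -> Omega -> R) (t : R)
    (m : nat) (z : 'cV[R]_m)
    (f : R -> Omega -> 'cV[R]_m -> 'cV[R]_m)
    (g : 'I_dW -> R -> Omega -> 'cV[R]_m -> 'cV[R]_m)
    (Z : process m) : Prop :=
  [/\ H2 t Z,
      {ae P, forall w, forall j,
        {within `[t, T], continuous (fun s => Z s w j 0)}} &
      forall s, s \in `[t, T] ->
        exists I : 'I_dW -> Omega -> 'cV[R]_m,
          (forall h j, is_ito_integral (W h) t s
             (fun r w => g h r w (Z r w) j 0) (fun w => I h w j 0)) /\
          {ae P, forall w, forall j,
            Z s w j 0 = z j 0
              + \int[lebesgue_measure]_(r in `[t, s]) f r w (Z r w) j 0
              + \sum_(h < dW) I h w j 0}].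

End stochastic_basis.

Section lq_game.
Context {R : realType} {N n dW : nat} {k : 'I_N -> nat}.

Local Notation K := (\sum_(i < N) k i)%N.

Definition stack (a : forall i, 'cV[R]_(k i)) : 'cV[R]_K := \mxcol_(i < N) a i.

(* E_i: identity in block i, zero in the other blocks. *)
Definition block_inj (i : 'I_N) : 'M[R]_(K, k i) :=
  \mxcol_(j < N) \matrix_(a < k j, b < k i) ((j == i) && (a == b :> nat))%:R.

Record lq_data := LQData {
  lqA : R -> 'M[R]_n ;
  lqB : R -> 'M[R]_(n, K) ;
  lqb : R -> 'cV[R]_n ;
  lqC : 'I_dW -> R -> 'M[R]_n ;
  lqD : 'I_dW -> R -> 'M[R]_(n, K) ;
  lqsigma : 'I_dW -> R -> 'cV[R]_n ;
  lqQ : 'I_N -> R -> 'M[R]_n ;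
  lqR : 'I_N -> R -> 'M[R]_K ;
  lqS : 'I_N -> R -> 'M[R]_(n, K) ;
  lqq : 'I_N -> R -> 'cV[R]_n ;
  lqrho : 'I_N -> R -> 'cV[R]_K ;
  lqG : 'I_N -> 'M[R]_n ;
  lqg : 'I_N -> 'cV[R]_n
}.

Record lq_regular (T : R) (c : lq_data) : Prop := LQRegular {
  lqA_Linfty : Linfty_mx T (lqA c) ;
  lqB_Linfty : Linfty_mx T (lqB c) ;
  lqb_L2 : L2_mx T (lqb c) ;
  lqC_Linfty : forall h, Linfty_mx T (lqC c h) ;
  lqD_Linfty : forall h, Linfty_mx T (lqD c h) ;
  lqsigma_L2 : forall h, L2_mx T (lqsigma c h) ;
  lqQ_Linfty : forall i, Linfty_mx T (lqQ c i) ;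
  lqQ_sym : forall i s, s \in `[0, T] -> (lqQ c i s)^T = lqQ c i s ;
  lqR_Linfty : forall i, Linfty_mx T (lqR c i) ;
  lqR_sym : forall i s, s \in `[0, T] -> (lqR c i s)^T = lqR c i s ;
  lqS_Linfty : forall i, Linfty_mx T (lqS c i) ;
  lqq_L2 : forall i, L2_mx T (lqq c i) ;
  lqrho_L2 : forall i, L2_mx T (lqrho c i) ;
  lqG_sym : forall i, (lqG c i)^T = lqG c i
}.

Definition potential_running (c : lq_data) (s : R) (x : 'cV[R]_n)
    (y : 'I_N -> 'cV[R]_n) (a : forall i, 'cV[R]_(k i)) : R :=
  let ybar := \sum_(i < N) y i in
  \sum_(i < N)
    (dotmx (y i) (lqQ c i s *m (x - 2^-1 *: ybar))
     + 2^-1 * dotmx (y i) (lqS c i s *m stack a)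
     + dotmx (lqq c i s) (y i)
     + dotmx (block_inj i *m a i)
         (2^-1 *: (lqR c i s *m stack a)
          + (lqS c i s)^T *m (x - 2^-1 *: ybar)
          + lqrho c i s)).

Definition potential_terminal (c : lq_data) (x : 'cV[R]_n)
    (y : 'I_N -> 'cV[R]_n) : R :=
  let ybar := \sum_(i < N) y i in
  \sum_(i < N)
    (dotmx (y i) (lqG c i *m (x - 2^-1 *: ybar)) + dotmx (lqg c i) (y i)).

Context {d : measure_display} {Omega : measurableType d}.
Variables (P : probability Omega R) (T t : R) (Flt : R -> set (set Omega)).

Definition profile : Type := forall i : 'I_N, @process d Omega R (k i).

Definition control (act : forall i, set 'cV[R]_(k i)) (i : 'I_N) :
    set (@process d Omega R (k i)) :=
  [set v | H2 P T Flt t v /\ forall s w, s \in `[t, T] -> act i (v s w)].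
Arguments control : clear implicits.

Definition control_profile (act : forall i, set 'cV[R]_(k i)) : set profile :=
  [set u | forall i, control act i (u i)].

Definition state_equation (W : 'I_dW -> R -> Omega -> R) (c : lq_data)
    (x : 'cV[R]_n) (u : profile) (X : process n) : Prop :=
  solves_sde P T Flt W t x
    (fun s w z => lqA c s *m z + lqB c s *m stack (fun i => u i s w) + lqb c s)
    (fun h s w z =>
       lqC c h s *m z + lqD c h s *m stack (fun i => u i s w) + lqsigma c h s)
    X.

Definition variational_equation (W : 'I_dW -> R -> Omega -> R) (c : lq_data)
    (i : 'I_N) (v : @process d Omega R (k i)) (Y : process n) : Prop :=
  solves_sde P T Flt W t 0
    (fun s w z => lqA c s *m z + (lqB c s *m block_inj i) *m v s w)
    (fun h s w z => lqC c h s *m z + (lqD c h s *m block_inj i) *m v s w)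
    Y.

(* X maps a control profile to its state process. Under [lq_regular] and
   [state_equation] the expectation is finite, so [fine] loses nothing. *)
Definition cost (c : lq_data) (X : profile -> @process d Omega R n) (i : 'I_N)
    (u : profile) : R :=
  2^-1 * fine 'E_P[fun w =>
    \int[lebesgue_measure]_(s in `[t, T])
      (let us := stack (fun j => u j s w) in
       dotmx (X u s w) (lqQ c i s *m X u s w)
       + dotmx us (lqR c i s *m us)
       + 2 * dotmx (X u s w) (lqS c i s *m us)
       + 2 * dotmx (lqq c i s) (X u s w)
       + 2 * dotmx (lqrho c i s) us)
    + dotmx (X u T w) (lqG c i *m X u T w)
    + 2 * dotmx (lqg c i) (X u T w)].

Definition linear_derivative (act : forall i, set 'cV[R]_(k i)) (i : 'I_N)
    (J : profile -> R) (dJ : profile -> @process d Omega R (k i) -> R) : Prop :=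
  (forall u, control_profile act u ->
     forall (a : R) v w,
       lin_span (control act i) v -> lin_span (control act i) w ->
       dJ u (a *: v + w) = a * dJ u v + dJ u w) /\
  (forall u v, control_profile act u -> control act i v ->
     (fun e : R => e^-1 * (J (dfwith u i (u i + e *: (v - u i))) - J u))
       @ 0^'+ --> dJ u (v - u i)).

Definition alpha_potential
    (dJ : forall i, profile -> @process d Omega R (k i) -> R) (u : profile) :
    R :=
  \int[lebesgue_measure]_(r in `[0, 1])
    (\sum_(i < N) dJ i (fun j => r *: u j) (u i)).

End lq_game.

Arguments lq_data R {N} n dW k.
Arguments profile R {N} k {d} Omega.

(* Main.v *)
Require Import Defs.
From HB Require Import structures.
From mathcomp Require Import all_boot all_order all_algebra.
From mathcomp Require Import all_classical all_reals all_analysis.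
From mathcomp Require Import measurable_realfun.
From mathcomp Require Import ring lra.

Set Implicit Arguments.
Unset Strict Implicit.
Unset Printing Implicit Defensive.

Import Order.TTheory GRing.Theory Num.Theory.
Import numFieldNormedType.Exports.

Local Open Scope classical_set_scope.
Local Open Scope ring_scope.

(** The costs are quadratic and the state is affine in the control, so along
    every segment of controls the cost of player [i] is a quadratic polynomial,
    and the potential is the integral over [0, 1] of an affine function of [r].

    The affine structure comes from uniqueness for linear stochastic
    differential equations.  If [X u] denotes the state driven by [u] and
    [Y i v] the variational process, then at every time, almost surely,
    [X u' = X u + e *: (Y i v - Y i (u i))] when [u'] is obtained from [u] by
    moving its [i]-th component to [u i + e *: (v - u i)], and
    [X (r u) = X u - (1 - r) *: \sum_j Y j (u j)]: in each case both sides solve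
    the same equation ([solution_pair_unique]).  Uniqueness comes from a second
    moment estimate and a Gronwall argument ([weak_solution_moment],
    [gronwall_eq0]).  The estimate rests on the Ito isometry, obtained from the
    independence of the Brownian increments ([increment_orth],
    [step_isometry]).  Since a difference of two Ito integrals is approximated
    by simple integrands over different subdivisions, the isometry is proved for
    finite sums of weighted increments over arbitrary intervals, which are
    closed under linear combinations without refining subdivisions.

    Write the cost of player [i] as [B(p, p) / 2 + L(p)], where [p] is the pair
    (state, control), [B] a symmetric bilinear form and [L] a linear form, both
    insensitive to changing processes on a null event at each time
    ([cost_quadratic], [bilin_cost_ext]).  The linear derivative at [u] in the
    direction [v - u i] is then [B(q, p) + L(q)], where [q] pairs
    [Y i v - Y i (u i)] with the corresponding change of control
    ([linear_derivativeE]).  At [r u] in the direction [u i], it is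
    [B(p_i, p + (r - 1) pbar) + L(p_i)], where [p_i] pairs [Y i (u i)] with the
    [i]-th block of the control and [pbar] is the sum of the [p_j].  Integrating
    over [r] replaces [r - 1] by [-1/2] ([alpha_potentialE]), and summing over
    [i] gives the announced integrands ([potential_mean]). *)

Local Notation dotmx := Defs.dotmx.

(** * Square-integrable functions *)

Section square_integrable.
Context {d : measure_display} {S : measurableType d} {R : realType}.
Variables (mu : {measure set S -> \bar R}) (D : set S).
Hypothesis mD : measurable D.
Implicit Types f g : S -> R.

Definition square_integrable f : Prop :=
  measurable_fun D f /\ (\int[mu]_(x in D) ((f x) ^+ 2)%:E < +oo)%E.

Lemma le_integrable_real f g : measurable_fun D f ->
  (forall x, D x -> `|f x| <= g x) -> mu.-integrable D (EFin \o g) ->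
  mu.-integrable D (EFin \o f).
Proof.
move=> mf fg ig; apply: (le_integrable mD _ _ ig) => /=; first exact/measurable_EFinP.
by move=> x Dx /=; rewrite lee_fin (le_trans (fg _ Dx))// ler_norm.
Qed.

Lemma square_integrableP f :
  square_integrable f <->
  measurable_fun D f /\ mu.-integrable D (EFin \o (fun x => f x ^+ 2)).
Proof.
split=> [[mf fo]|[mf /integrableP[_ fo]]]; split=> //.
- apply/integrableP; split; first exact/measurable_EFinP/measurable_funX.
  by under eq_integral do rewrite /= ger0_norm ?sqr_ge0//.
- by under eq_integral do rewrite -[X in X%:E]ger0_norm ?sqr_ge0//.
Qed.

Lemma square_integrable_mul f g : square_integrable f -> square_integrable g ->
  mu.-integrable D (EFin \o (fun x => f x * g x)).
Proof.
move=> /square_integrableP[mf f2] /square_integrableP[mg g2].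
apply: (@le_integrable_real _ (fun x => f x ^+ 2 + g x ^+ 2)).
- exact: measurable_funM.
- move=> x _; rewrite ler_norml; nra.
- exact: (integrableD mD f2 g2).
Qed.

Lemma square_integrableZ a f : square_integrable f ->
  square_integrable (fun x => a * f x).
Proof.
move=> /square_integrableP[mf f2]; apply/square_integrableP; split.
  exact: measurable_funM.
rewrite (_ : _ \o _ = (fun x => (a ^+ 2)%:E * (f x ^+ 2)%:E)%E).
  exact: (integrableZl mD _ f2).
by apply/funext => x /=; rewrite exprMn.
Qed.

Lemma square_integrableD f g : square_integrable f -> square_integrable g ->
  square_integrable (fun x => f x + g x).
Proof.
move=> /square_integrableP[mf f2] /square_integrableP[mg g2].
apply/square_integrableP; split; first exact: measurable_funD.
apply: (@le_integrable_real _ (fun x => 2 * (f x ^+ 2 + g x ^+ 2))).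
- by apply: measurable_funX; exact: measurable_funD.
- move=> x _; rewrite ger0_norm ?sqr_ge0//.
  by have := sqr_ge0 (f x - g x); nra.
- exact: (integrableZl mD 2 (integrableD mD f2 g2)).
Qed.

Lemma square_integrable0 : square_integrable (fun=> 0).
Proof.
split; first exact: measurable_cst.
by rewrite integral0_eq ?ltry// => x _; rewrite expr0n.
Qed.

Lemma square_integrable_sum I (s : seq I) (f : I -> S -> R) :
  (forall i, square_integrable (f i)) ->
  square_integrable (fun x => \sum_(i <- s) f i x).
Proof.
move=> fi; elim: s => [|i s ih].
  by under eq_fun do rewrite big_nil; exact: square_integrable0.
by under eq_fun do rewrite big_cons; exact: square_integrableD.
Qed.

Lemma square_integrable_ae_bounded (c : S -> R) (M : R) f :
  measurable_fun D c -> {ae mu, forall x, D x -> `|c x| <= M} ->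
  square_integrable f ->
  square_integrable (fun x => c x * f x) /\
  \int[mu]_(x in D) (c x * f x) ^+ 2 <= M ^+ 2 * \int[mu]_(x in D) f x ^+ 2.
Proof.
move=> mc cM /square_integrableP[mf f2].
have mcf : measurable_fun D (fun x => c x * f x) by exact: measurable_funM.
have le_int : (\int[mu]_(x in D) ((c x * f x) ^+ 2)%:E <=
    (M ^+ 2)%:E * \int[mu]_(x in D) (f x ^+ 2)%:E)%E.
  rewrite -(integralZl mD f2).
  apply: ae_ge0_le_integral => //.
  - by move=> x _; rewrite lee_fin sqr_ge0.
  - exact/measurable_EFinP/measurable_funX.
  - by move=> x _; rewrite -EFinM lee_fin mulr_ge0// sqr_ge0.
  - apply/measurable_EFinP; apply: measurable_funM => //.
    exact: measurable_funX.
  - move: cM; apply: filterS => x cM Dx; rewrite -EFinM lee_fin exprMn.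
    rewrite ler_wpM2r ?sqr_ge0//.
    by rewrite -[leLHS]real_normK ?num_real// lerXn2r ?nnegrE//
      ?(le_trans _ (cM Dx)) ?cM.
have fin2 : (\int[mu]_(x in D) (f x ^+ 2)%:E)%E \is a fin_num.
  exact: (integrable_fin_num mD f2).
have lty : (\int[mu]_(x in D) ((c x * f x) ^+ 2)%:E < +oo)%E.
  by rewrite (le_lt_trans le_int)// -(fineK fin2) -EFinM ltry.
split=> //; rewrite /Rintegral -lee_fin EFinM !fineK//.
by rewrite ge0_fin_numE// integral_ge0// => x _; rewrite lee_fin sqr_ge0.
Qed.

Lemma EFin_Rintegral f : mu.-integrable D (EFin \o f) ->
  (\int[mu]_(x in D) f x)%:E = (\int[mu]_(x in D) (f x)%:E)%E.
Proof. by move=> fi; rewrite fineK// (integrable_fin_num mD fi). Qed.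

Lemma integrable_sum_real I (s : seq I) (f : I -> S -> R) :
  (forall i, mu.-integrable D (EFin \o f i)) ->
  mu.-integrable D (EFin \o (fun x => \sum_(i <- s) f i x)).
Proof.
move=> fi; have -> : EFin \o (fun x => \sum_(i <- s) f i x) =
    (fun x => \sum_(i <- s) (f i x)%:E)%E.
  by apply/funext => x /=; rewrite sumEFin.
by apply: (integrable_sum mD) => i _; exact: fi.
Qed.

Lemma Rintegral_sum I (s : seq I) (f : I -> S -> R) :
  (forall i, mu.-integrable D (EFin \o f i)) ->
  \int[mu]_(x in D) \sum_(i <- s) f i x = \sum_(i <- s) \int[mu]_(x in D) f i x.
Proof.
move=> fi; elim: s => [|i s ih].
  under eq_Rintegral do rewrite big_nil.
  by rewrite big_nil Rintegral_cst// mul0r.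
under eq_Rintegral do rewrite big_cons.
by rewrite big_cons RintegralD ?ih//; exact: integrable_sum_real.
Qed.

(** The defect in this inequality is the integral of the square of
    [mu D * f - \int f], divided by [mu D]. *)
Lemma sqr_Rintegral_le f : (mu D < +oo)%E -> square_integrable f ->
  mu.-integrable D (EFin \o f) /\
  (\int[mu]_(x in D) f x) ^+ 2 <= fine (mu D) * \int[mu]_(x in D) f x ^+ 2.
Proof.
move=> Dfin fs; have /square_integrableP[mf f2] := fs.
have i1 (r : R) : mu.-integrable D (EFin \o (fun=> r)).
  by apply: measurable_bounded_integrable => //; exact: bounded_cst.
have if1 : mu.-integrable D (EFin \o f).
  apply: (@le_integrable_real _ (fun x => 1 + f x ^+ 2)) => //.
    by move=> x _; rewrite ler_norml; nra.
  exact: (integrableD mD (i1 1) f2).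
split=> //; set c := fine (mu D); set m := Rintegral _ _ f.
set q := Rintegral _ _ (fun x => _ ^+ 2).
have c0 : 0 <= c by rewrite fine_ge0.
have : 0 <= \int[mu]_(x in D) (c * f x - m) ^+ 2.
  by apply: Rintegral_ge0 => x _; exact: sqr_ge0.
have -> : \int[mu]_(x in D) (c * f x - m) ^+ 2 =
    c ^+ 2 * q - 2 * c * m * m + m ^+ 2 * c.
  rewrite -[X in _ + X]Rintegral_cst//.
  rewrite -(RintegralZl _ _ f2)// -(RintegralZl _ _ if1)//.
  rewrite -RintegralB//; first last.
  - exact: (integrableZl mD _ if1).
  - exact: (integrableZl mD _ f2).
  rewrite -RintegralD//; last first.
    exact: (integrableB mD (integrableZl mD _ f2) (integrableZl mD _ if1)).
  by apply: eq_Rintegral => x _; ring.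
have [c_eq0|c_neq0] := eqVneq c 0.
  move=> _; have -> : m = 0; last first.
    by rewrite expr0n mulr_ge0// Rintegral_ge0// => x _; rewrite sqr_ge0.
  rewrite /m /Rintegral null_set_integral//; first exact/measurable_EFinP.
  by rewrite -(fineK (_ : mu D \is a fin_num)) ?ge0_fin_numE// -/c c_eq0.
have c_gt0 : 0 < c by rewrite lt_def c_neq0.
by move=> h; rewrite -(ler_pM2l c_gt0) -subr_ge0; apply: le_trans h _; nra.
Qed.

Lemma sqr_integral_ltP f (eps : R) : measurable_fun D f ->
  (\int[mu]_(x in D) ((f x) ^+ 2)%:E < eps%:E)%E <->
  square_integrable f /\ \int[mu]_(x in D) f x ^+ 2 < eps.
Proof.
move=> mf; have fin2 : square_integrable f ->
    (\int[mu]_(x in D) f x ^+ 2)%:E = (\int[mu]_(x in D) ((f x) ^+ 2)%:E)%E.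
  by move=> /square_integrableP[_ /EFin_Rintegral].
split=> [lt_eps|[sf]]; last by rewrite -lte_fin fin2.
have sf : square_integrable f by split => //; exact: (lt_trans lt_eps (ltry _)).
by split => //; rewrite -lte_fin fin2.
Qed.

Lemma Rintegral_sqrD_le a f g : square_integrable f -> square_integrable g ->
  \int[mu]_(x in D) (a * f x + g x) ^+ 2 <=
    2 * (a ^+ 2 * \int[mu]_(x in D) f x ^+ 2 + \int[mu]_(x in D) g x ^+ 2).
Proof.
move=> sf sg; have saf := square_integrableZ a sf.
have /square_integrableP[_ if2] := sf; have /square_integrableP[_ ig2] := sg.
have /square_integrableP[_ ia2] := square_integrableD saf sg.
have iaf2 := integrableZl mD (a ^+ 2) if2.
rewrite -RintegralZl// -RintegralD// -RintegralZl//; last exact: (integrableD mD iaf2 ig2).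
apply: le_Rintegral => //; first exact: (integrableZl mD 2 (integrableD mD iaf2 ig2)).
by move=> x _; have := sqr_ge0 (a * f x - g x); nra.
Qed.

Lemma Rintegral_sqr_sum_le I (s : seq I) (f : I -> S -> R) :
  (forall i, square_integrable (f i)) ->
  \int[mu]_(x in D) (\sum_(i <- s) f i x) ^+ 2 <=
    2 ^+ size s * \sum_(i <- s) \int[mu]_(x in D) f i x ^+ 2.
Proof.
move=> sf; elim: s => [|i s ih].
  under eq_Rintegral do rewrite big_nil expr0n.
  by rewrite big_nil Rintegral_cst// mul0r mulr0.
under eq_Rintegral do rewrite big_cons -[X in X + _]mul1r.
rewrite big_cons; set u := \int[mu]_(x in D) f i x ^+ 2; set v := \sum_(j <- s) _.
have ss := square_integrable_sum s sf.
apply: (le_trans (Rintegral_sqrD_le 1 (sf i) ss)).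
rewrite expr1n mul1r exprS -mulrA ler_pM2l// mulrDr lerD//.
have u0 : 0 <= u by apply: Rintegral_ge0 => x _; exact: sqr_ge0.
by rewrite ler_peMl// exprn_ege1// ler1n.
Qed.

End square_integrable.

(** * Integration over time strips *)

Section time_strip.
Context {d : measure_display} {Omega : measurableType d} {R : realType}.
Variable P : probability Omega R.
Implicit Types (a b : R) (f : measurableTypeR R * Omega -> R).

Definition time_prod : {measure set (measurableTypeR R * Omega) -> \bar R} :=
  (lebesgue_measure \x P)%E.

Definition strip a b : set (measurableTypeR R * Omega) := `[a, b] `*` [set: Omega].

Lemma measurable_strip a b : measurable (strip a b).
Proof. by apply: measurableX => //; exact: measurable_itv. Qed.
Hint Resolve measurable_strip : core.

Lemma strip_subset a b a' b' : a' <= a -> b <= b' -> strip a b `<=` strip a' b'.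
Proof.
move=> aa bb [s w] [/=]; rewrite !in_itv/= => /andP[as_ sb] _; split => //=.
by rewrite in_itv/= (le_trans aa as_) (le_trans sb bb).
Qed.

Lemma measurable_time_section a b f s : s \in `[a, b] ->
  measurable_fun (strip a b) f -> measurable_fun setT (fun w => f (s, w)).
Proof.
move=> sab mf.
apply: (@measurable_comp _ _ _ _ _ _ (strip a b) f setT (fun w => (s, w))) => //.
  by move=> _ [w _ <-]; split.
exact: pair1_measurable.
Qed.

Lemma measurable_path_section a b f w :
  measurable_fun (strip a b) f -> measurable_fun `[a, b] (fun s => f (s, w)).
Proof.
move=> mf.
apply: (@measurable_comp _ _ _ _ _ _ (strip a b) f `[a, b] (fun s => (s, w))) => //.
  by move=> _ [s sab <-]; split.
exact: measurable_funTS (pair2_measurable w).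
Qed.

Lemma measurable_time_fun a b (c : R -> R) :
  measurable_fun `[a, b] c -> measurable_fun (strip a b) (fun p => c p.1).
Proof.
move=> mc.
apply: (@measurable_comp _ _ _ _ _ _ `[a, b] (c : measurableTypeR R -> R) _ fst) => //.
- by move=> _ [[s w] [sab _] <-].
- exact: measurable_funTS.
Qed.

Lemma measurable_omega_fun a b (xi : Omega -> R) :
  measurable_fun setT xi -> measurable_fun (strip a b) (fun p => xi p.2).
Proof. by move=> mxi; apply: measurable_funTS; exact: measurableT_comp. Qed.

Let patch_strip f a b s w : ((EFin \o f) \_ (strip a b)) (s, w) =
  ((fun s => (f (s, w))%:E) \_ `[a, b]) s.
Proof.
by rewrite !patchE; congr (if _ then _ else _); apply/idP/idP => [|];
  rewrite !inE => // -[].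
Qed.

Let patch_stripG f a b w :
  (\int[lebesgue_measure]_s ((EFin \o f) \_ (strip a b)) (s, w) =
   \int[lebesgue_measure]_(s in `[a, b]) (f (s, w))%:E)%E.
Proof.
by rewrite [RHS]integral_mkcond; apply: eq_integral => s _; rewrite patch_strip.
Qed.

Let patch_stripF f a b s :
  (\int[P]_w ((EFin \o f) \_ (strip a b)) (s, w) =
   ((fun s => \int[P]_w (f (s, w))%:E) \_ `[a, b]) s)%E.
Proof.
rewrite patchE; case: ifPn => sab.
  by apply: eq_integral => w _; rewrite patch_strip patchE sab.
by rewrite integral0_eq// => w _; rewrite patch_strip patchE (negbTE sab).
Qed.

Lemma strip_tonelli a b f : measurable_fun (strip a b) f ->
  (forall p, strip a b p -> 0 <= f p) ->
  (\int[P]_w \int[lebesgue_measure]_(s in `[a, b]) (f (s, w))%:E =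
     \int[time_prod]_(p in strip a b) (f p)%:E /\
   \int[lebesgue_measure]_(s in `[a, b]) \int[P]_w (f (s, w))%:E =
     \int[time_prod]_(p in strip a b) (f p)%:E)%E.
Proof.
move=> mf f0; set g := (EFin \o f) \_ (strip a b).
have mg : measurable_fun setT g.
  apply: (measurable_restrictT _ (measurable_strip a b)).1.
  exact/measurable_EFinP.
have g0 p : (0 <= g p)%E.
  by rewrite /g patchE; case: ifPn => //; rewrite inE lee_fin; exact: f0.
split; rewrite [RHS]integral_mkcond -/g.
- rewrite (fubini_tonelli2 g mg g0); apply: eq_integral => w _.
  by rewrite /fubini_G patch_stripG.
- rewrite (fubini_tonelli1 g mg g0) [LHS]integral_mkcond.
  by apply: eq_integral => s _; rewrite /fubini_F patch_stripF.
Qed.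

Lemma strip_tonelli_measurable a b f : measurable_fun (strip a b) f ->
  (forall p, strip a b p -> 0 <= f p) ->
  measurable_fun `[a, b] (fun s => \int[P]_w (f (s, w))%:E)%E.
Proof.
move=> mf f0; set g := (EFin \o f) \_ (strip a b).
have mg : measurable_fun setT g.
  apply: (measurable_restrictT _ (measurable_strip a b)).1.
  exact/measurable_EFinP.
have g0 p : (0 <= g p)%E.
  by rewrite /g patchE; case: ifPn => //; rewrite inE lee_fin; exact: f0.
have := measurable_fun_fubini_tonelli_F (m2 := P) g mg g0.
move=> /(measurable_funS measurableT (@subsetT _ `[a, b])).
apply: eq_measurable_fun => s sab.
by rewrite /fubini_F patch_stripF patchE sab.
Qed.

(** The inner integral can be infinite on a null event, where the real-valued
    integral takes a default value, hence the detour through [integrable_ae]. *)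
Lemma strip_fubini a b f : time_prod.-integrable (strip a b) (EFin \o f) ->
  [/\ {ae P, forall w, lebesgue_measure.-integrable `[a, b]
         (EFin \o (fun s => f (s, w)))},
      P.-integrable setT
        (EFin \o (fun w => \int[lebesgue_measure]_(s in `[a, b]) f (s, w))) &
      \int[P]_w \int[lebesgue_measure]_(s in `[a, b]) f (s, w) =
        \int[time_prod]_(p in strip a b) f p].
Proof.
move=> fi; set g := (EFin \o f) \_ (strip a b).
have gi : time_prod.-integrable setT g.
  exact: (integrable_mkcond _ (measurable_strip a b)).1.
have ae1 := ae_integrable2 gi.
have Gi : P.-integrable setT (fubini_G lebesgue_measure g).
  have mg : measurable_fun setT g := measurable_int _ gi.
  have mG0 : measurable_fun setT (fubini_G lebesgue_measure g).
    exact: measurable_fubini_G gi.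
  apply/integrableP; split => //.
  have /(integrable21ltyP lebesgue_measure P mg) := gi; apply: le_lt_trans.
  apply: ge0_le_integral => //.
  - exact: measurableT_comp.
  - apply: (measurable_fun_fubini_tonelli_G (abse \o g)).
      exact: measurableT_comp.
    by move=> p; exact: abse_ge0.
  - move=> w _; apply: le_abse_integral => //.
    by apply: measurableT_comp => //; exact: pair2_measurable.
have GE : fubini_G lebesgue_measure g =
    fun w => (\int[lebesgue_measure]_(s in `[a, b]) (f (s, w))%:E)%E.
  by apply/funext => w; exact: patch_stripG.
have mG : measurable_fun setT (EFin \o fine \o fubini_G lebesgue_measure g).
  apply/measurable_EFinP; apply: measurableT_comp; first exact: fine_measurable.
  exact: (measurable_int _ Gi).
have Ri : P.-integrable setT (EFin \o fine \o fubini_G lebesgue_measure g).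
  apply: le_integrable Gi => // w _ /=.
  by case: (fubini_G _ _ w) => [r||]; rewrite /= ?normr0 ?leey.
have mab : measurable (`[a, b] : set (measurableTypeR R)) by exact: measurable_itv.
split.
- move: ae1; apply: filterS => w gw.
  apply: (integrable_mkcond (EFin \o (fun s => f (s, w))) mab).2.
  by apply: eq_integrable gw => // s _; exact: patch_strip.
- by move: Ri; rewrite GE.
- rewrite /Rintegral [in RHS]integral_mkcond -/g.
  rewrite -(integral21_prod_meas1 gi); congr fine.
  apply: ae_eq_integral => //.
  + by move: mG; rewrite GE.
  + exact: (measurable_int _ Gi).
  + have := integrable_ae measurableT Gi; apply: filterS => w /(_ I) Gw _.
    by rewrite -[RHS](fineK Gw) GE.
Qed.

(** Uniqueness for a stochastic differential equation gives equality almost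
    surely at each fixed time; by Tonelli the exceptional set is then null for
    the product measure. *)
Lemma strip_ae_eq0 a b f : measurable_fun (strip a b) f ->
  (forall s, s \in `[a, b] -> {ae P, forall w, f (s, w) = 0}) ->
  (\int[time_prod]_(p in strip a b) (f p)%:E = 0)%E.
Proof.
move=> mf f0; have mEf : measurable_fun (strip a b) (EFin \o f).
  exact/measurable_EFinP.
rewrite (ae_eq_integral (cst 0%E))//.
  by rewrite integral0_eq.
apply/(ae_eq_integral_abs _ (measurable_strip a b) mEf).
have mn : measurable_fun (strip a b) (fun p => `|f p|).
  exact: measurableT_comp.
transitivity (\int[time_prod]_(p in strip a b) (`|f p|)%:E)%E => //.
rewrite -(strip_tonelli mn (fun _ _ => normr_ge0 _)).2.
apply: integral0_eq => s sab.
have mfs : measurable_fun setT (EFin \o (fun w => f (s, w))).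
  by apply/measurable_EFinP; exact: measurable_time_section sab mf.
apply/(ae_eq_integral_abs P measurableT mfs).
by move: (f0 _ sab); apply: filterS => w /= -> _.
Qed.

Lemma strip_Rintegral_ae_eq0 a b f : measurable_fun (strip a b) f ->
  (forall s, s \in `[a, b] -> {ae P, forall w, f (s, w) = 0}) ->
  \int[time_prod]_(p in strip a b) f p = 0.
Proof. by move=> mf f0; rewrite /Rintegral strip_ae_eq0. Qed.

Lemma strip_finite a b : (time_prod (strip a b) < +oo)%E.
Proof.
have -> : time_prod (strip a b) = (lebesgue_measure `[a, b] * P setT)%E.
  by rewrite -(product_measure1E lebesgue_measure P)//; exact: measurable_itv.
by rewrite probability_setT mule1 lebesgue_measure_itv/=; case: ifP; rewrite ?ltry.
Qed.

End time_strip.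

(** * Moments of the normal law *)

Section normal_moments.
Context {R : realType}.
Local Notation mu := (@lebesgue_measure R).
Import HBNNSimple.

Let pdf_ge0E (s x : R) : (0 <= (normal_pdf 0 s x)%:E)%E.
Proof. by rewrite lee_fin normal_pdf_ge0. Qed.

Let integral_normal_prob_nnsfun (s : R) (f : {nnsfun _ >-> R}) :
  (\int[normal_prob 0 s]_x (f x)%:E =
   \int[mu]_x ((f x)%:E * (normal_pdf 0 s x)%:E))%E.
Proof.
have mpdf : measurable_fun setT (fun x => (normal_pdf 0 s x)%:E).
  by apply/measurable_EFinP; exact: measurable_normal_pdf.
under [LHS]eq_integral do rewrite fimfunE -fsumEFin//.
rewrite [LHS]ge0_integral_fsum//; last 2 first.
  - by move=> r; exact/measurable_EFinP/measurableT_comp.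
  - by move=> n x _; rewrite EFinM nnfun_muleindic_ge0.
under [RHS]eq_integral.
  move=> x xD; rewrite fimfunE -fsumEFin// ge0_mule_fsuml; last first.
    by move=> r; rewrite EFinM nnfun_muleindic_ge0.
  over.
rewrite [RHS]ge0_integral_fsum//; last 2 first.
  - move=> r; apply: emeasurable_funM => //.
    by apply/measurable_EFinP; do 2 apply/measurableT_comp => //.
  - by move=> n x _; rewrite EFinM mule_ge0// nnfun_muleindic_ge0.
apply: eq_fsbigr => r _.
rewrite integralZl_indic_nnsfun//= integral_indic// setIT.
have [r0|r0] := leP 0 r; last first.
  rewrite preimage_nnfun0// measure0 mule0 integral0_eq// => x _.
  by rewrite indic0 mulr0 mul0e.
under [RHS]eq_integral do rewrite EFinM -muleA.
rewrite ge0_integralZl//; last 2 first.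
  - apply: emeasurable_funM => //.
    by apply/measurable_EFinP; exact: measurable_indic.
  - by move=> x _; rewrite mule_ge0// lee_fin indicE.
congr (_ * _)%E.
transitivity (\int[mu]_(x in f @^-1` [set r]) (normal_pdf 0 s x)%:E)%E => //.
rewrite [LHS]integral_mkcond.
apply: eq_integral => x _; rewrite patchE indicE.
by case: ifPn => xf; rewrite ?mul1e ?mul0e.
Qed.

(** [normal_prob] is defined by its density; the formula passes from indicators
    to simple functions and then to monotone limits. *)
Lemma ge0_integral_normal_prob (s : R) (f : measurableTypeR R -> \bar R) :
  measurable_fun setT f -> (forall x, 0 <= f x)%E ->
  (\int[normal_prob 0 s]_x f x = \int[mu]_x (f x * (normal_pdf 0 s x)%:E))%E.
Proof.
move=> mf f0; pose f_ := nnsfun_approx measurableT mf.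
have mpdf : measurable_fun setT (fun x => (normal_pdf 0 s x)%:E).
  by apply/measurable_EFinP; exact: measurable_normal_pdf.
transitivity (lim (\int[normal_prob 0 s]_x (f_ n x)%:E @[n --> \oo])%E).
  rewrite -monotone_convergence//=.
  - apply: eq_integral => ? /[!inE] xD; apply/esym/cvg_lim => //=.
    exact: cvg_nnsfun_approx.
  - by move=> n; exact/measurable_EFinP/measurable_funTS.
  - by move=> n ? _; rewrite lee_fin.
  - by move=> ? _ ? ? mn; rewrite lee_fin; exact/lefP/nd_nnsfun_approx.
rewrite [RHS](_ : _ = lim
    (\int[mu]_x ((f_ n x)%:E * (normal_pdf 0 s x)%:E) @[n --> \oo])%E).
  by apply: congr_lim; apply/funext => n /=; exact: integral_normal_prob_nnsfun.
rewrite -monotone_convergence//=.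
- apply: eq_integral => x /[!inE] xD; apply/esym/cvg_lim => //=.
  by apply: cvgeZr => //; exact: cvg_nnsfun_approx.
- move=> n; apply: emeasurable_funM => //.
  exact/measurable_EFinP/measurable_funTS.
- by move=> n ? _; rewrite mule_ge0// lee_fin.
- move=> x _ ? ? mn; rewrite lee_pmul//.
    by rewrite lee_fin.
  by rewrite lee_fin; exact/lefP/nd_nnsfun_approx.
Qed.

(** This number is 1; carrying it as a constant factor spares its evaluation. *)
Definition normal_moment2 : R := \int[normal_prob 0 1]_x (x ^+ 2).

Let moment2_integrand (s x : R) : R := x ^+ 2 * normal_pdf 0 s x.

Let moment2_integrandE (s : R) :
  (\int[normal_prob 0 s]_x (x ^+ 2)%:E = \int[mu]_x (moment2_integrand s x)%:E)%E.
Proof.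
rewrite ge0_integral_normal_prob//.
- by apply/measurable_EFinP; exact: measurable_funX.
- by move=> x; rewrite lee_fin sqr_ge0.
Qed.

(** The bound [x ^+ 2 <= 4 * expR (x ^+ 2 / 4)] trades the square for half of
    the Gaussian exponent, leaving a centred Gaussian of variance 2. *)
Lemma integrable_normal_moment2 :
  (\int[normal_prob 0 1]_x (x ^+ 2)%:E = normal_moment2%:E :> \bar R)%E.
Proof.
rewrite fineK// ge0_fin_numE; last first.
  by apply: integral_ge0 => x _; rewrite lee_fin sqr_ge0.
rewrite moment2_integrandE.
set c : R := 4 * normal_peak 1 / normal_peak (Num.sqrt 2).
apply: (@le_lt_trans _ _ (\int[mu]_x (c%:E * (normal_pdf 0 (Num.sqrt 2) x)%:E))%E).
  have s20 : Num.sqrt 2 != 0 :> R by rewrite gt_eqF// sqrtr_gt0.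
  apply: ge0_le_integral => //.
  - by move=> x _; rewrite lee_fin mulr_ge0 ?sqr_ge0 ?normal_pdf_ge0.
  - apply/measurable_EFinP/measurable_funM; last exact: measurable_normal_pdf.
    exact: measurable_funX.
  - apply/measurable_EFinP/measurable_funM => //; exact: measurable_normal_pdf.
  move=> x _; rewrite -EFinM lee_fin /moment2_integrand !normal_pdfE ?oner_eq0//.
  have -> : c * (normal_peak (Num.sqrt 2) * normal_fun 0 (Num.sqrt 2) x) =
      normal_peak 1 * (4 * normal_fun 0 (Num.sqrt 2) x).
    by rewrite /c; field; rewrite gt_eqF// normal_peak_gt0.
  rewrite mulrCA ler_wpM2l ?normal_peak_ge0// /normal_fun sqr_sqrtr// !subr0 expr1n.
  set y := x ^+ 2 / 4.
  have -> : - x ^+ 2 / (1 *+ 2) = - y + - y :> R by rewrite /y; field.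
  have -> : - x ^+ 2 / (2 *+ 2) = - y :> R by rewrite /y; field.
  rewrite expRD mulrA ler_wpM2r ?expR_ge0// expRN ler_pdivrMr ?expR_gt0//.
  have := expR_ge1Dx y; have -> : x ^+ 2 = 4 * y by rewrite /y; field.
  by nra.
rewrite ge0_integralZl//=.
- by rewrite integral_normal_pdf mule1 ltry.
- by apply/measurable_EFinP; exact: measurable_normal_pdf.
- by rewrite lee_fin divr_ge0 ?mulr_ge0 ?normal_peak_ge0.
Qed.

(** The substitution [y = x / s] reduces the second moment to that of the
    standard law. *)
Lemma normal_prob_moment2 (s : R) : 0 < s ->
  (\int[normal_prob 0 s]_x (x ^+ 2)%:E = (s ^+ 2 * normal_moment2)%:E :> \bar R)%E.
Proof.
move=> s0; rewrite EFinM -integrable_normal_moment2 !moment2_integrandE.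
have s_neq0 : s != 0 by rewrite gt_eqF.
pose F (x : R^o) := x / s.
have F'E : F^`()%classic = cst s^-1.
  apply/funext => x; rewrite /F derive1E deriveM// derive_cst scaler0.
  by rewrite add0r derive_id scaler1.
rewrite (@increasing_ge0_integration_by_substitutionT _ F (moment2_integrand 1)).
- rewrite -ge0_integralZl//=.
  + apply: eq_integral => x _; rewrite -EFinM; congr EFin.
    rewrite F'E /moment2_integrand !fctE/= !normal_pdfE ?oner_eq0//.
    have -> : normal_peak s = normal_peak 1 / s.
      rewrite /normal_peak -mulrnAr sqrtrM ?sqr_ge0// sqrtr_sqr gtr0_norm//.
      by rewrite -mulrnAr expr1n mul1r invfM mulrC.
    have -> : normal_fun 0 1 (F x) = normal_fun 0 s x.
      by rewrite /normal_fun /F !subr0 expr1n; congr expR; field.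
    by rewrite /F; field.
  + apply/measurable_EFinP; rewrite F'E; apply: measurable_funM => //.
    apply: (@measurableT_comp _ _ _ _ _ _ (moment2_integrand 1) _ F).
      by apply: measurable_funM; [exact: measurable_funX|exact: measurable_normal_pdf].
    by apply: measurable_funM => //; exact: measurable_id.
  + move=> x _; rewrite lee_fin /moment2_integrand F'E !fctE.
    apply: mulr_ge0; last by rewrite /= invr_ge0 ltW.
    by apply: mulr_ge0; [exact: sqr_ge0|exact: normal_pdf_ge0].
  + by rewrite lee_fin sqr_ge0.
- by move=> x y xy; rewrite /F ltr_pM2r ?invr_gt0.
- by rewrite F'E => ?; exact: cvg_cst.
- by rewrite F'E; exact: is_cvg_cst.
- by rewrite F'E; exact: is_cvg_cst.
- by [].
- apply/gt0_cvgMlNy; last exact: cvg_id.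
  by rewrite invr_gt0.
- apply/gt0_cvgMly; last exact: cvg_id.
  by rewrite invr_gt0.
- move=> x; apply: cvgM; first exact: exprn_continuous.
  by apply: continuous_normal_pdf; rewrite oner_eq0.
- by move=> x; rewrite mulr_ge0 ?sqr_ge0 ?normal_pdf_ge0.
Qed.

End normal_moments.

Section normal_symmetry.
Context {R : realType}.

Lemma normal_probN (s : R) (A : set R) : s != 0 -> measurable A ->
  normal_prob 0 s (-%R @^-1` A) = normal_prob 0 s A :> \bar R.
Proof.
move=> s0 mA; rewrite /normal_prob.
transitivity (\int[pushforward lebesgue_measure
    (-%R : measurableTypeR R -> measurableTypeR R)]_(x in A)
      (normal_pdf 0 s x)%:E)%E; last first.
  by apply: eq_measure_integral => B mB _; exact: lebesgue_measureN.
rewrite ge0_integral_pushforward//.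
- apply: eq_integral => x _ /=; congr EFin.
  by rewrite !normal_pdfE// /normal_fun !subr0 sqrrN.
- by apply/measurable_EFinP/measurable_funTS; exact: measurable_normal_pdf.
- by move=> x _; rewrite lee_fin normal_pdf_ge0.
Qed.

End normal_symmetry.

Section normal_law.
Context {d : measure_display} {Omega : measurableType d} {R : realType}.
Variable P : probability Omega R.

(** The mean vanishes because [Z] and [- Z] have the same law. *)
Lemma normal_law_moments (Z : Omega -> R) (s : R) : 0 < s ->
  measurable_fun setT Z ->
  (forall U, measurable U -> P (Z @^-1` U) = normal_prob 0 s U) ->
  [/\ square_integrable P setT Z,
      \int[P]_w (Z w ^+ 2) = s ^+ 2 * @normal_moment2 R &
      \int[P]_w Z w = 0].
Proof.
move=> s0 mZ lawZ.
have ge0_lawE (f : R -> \bar R) : measurable_fun setT f -> (forall x, 0 <= f x)%E ->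
    (\int[P]_w f (Z w) = \int[normal_prob 0 s]_x f x)%E.
  move=> mf f0; transitivity (\int[pushforward P (Z : Omega -> measurableTypeR R)]_x f x)%E.
    by rewrite ge0_integral_pushforward.
  by apply: eq_measure_integral => A mA _; exact: lawZ.
have Z2 : (\int[P]_w (Z w ^+ 2)%:E = (s ^+ 2 * @normal_moment2 R)%:E)%E.
  rewrite (ge0_lawE (fun x => (x ^+ 2)%:E)) ?normal_prob_moment2//.
  - by apply/measurable_EFinP; exact: measurable_funX.
  - by move=> x; rewrite lee_fin sqr_ge0.
have sZ : square_integrable P setT Z by split => //; rewrite Z2 ltry.
split=> //; first by rewrite /Rintegral Z2.
have Pfin : (P setT < +oo)%E by rewrite probability_setT ltry.
have [iZ _] := sqr_Rintegral_le measurableT Pfin sZ.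
have mNZ : measurable_fun setT (fun w => - Z w) by exact: measurableT_comp.
suff : \int[P]_w Z w = - \int[P]_w Z w by lra.
rewrite -[RHS]mulN1r -RintegralZl//.
under [RHS]eq_Rintegral do rewrite mulN1r.
rewrite /Rintegral; congr fine.
transitivity (\int[pushforward P (Z : Omega -> measurableTypeR R)]_x x%:E)%E.
  by rewrite integral_pushforward//; exact/measurable_EFinP.
transitivity (\int[pushforward P ((fun w => - Z w)%R : Omega -> measurableTypeR R)]_x x%:E)%E.
  apply: eq_measure_integral => A mA _.
  transitivity (normal_prob 0 s A); first exact: lawZ.
  transitivity (normal_prob 0 s (-%R @^-1` A)).
    by rewrite normal_probN// gt_eqF.
  symmetry; apply: (lawZ (-%R @^-1` A)).
  by rewrite -[X in measurable X]setTI; exact: oppr_measurable.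
rewrite integral_pushforward// preimage_setT.
exact: integrableN iZ.
Qed.

End normal_law.

(** * Expectation of a product of independent variables *)

Section independence.
Context {d : measure_display} {Omega : measurableType d} {R : realType}.
Variable P : probability Omega R.

(** Independence says that the joint law agrees with the product of the laws on
    rectangles, hence everywhere; Fubini then separates the factors. *)
Lemma Rintegral_indep_mul (X Z : Omega -> R) :
  measurable_fun setT X -> measurable_fun setT Z ->
  (forall U V, measurable U -> measurable V ->
    P (X @^-1` U `&` Z @^-1` V) = P (X @^-1` U) * P (Z @^-1` V))%E ->
  P.-integrable setT (EFin \o X) -> P.-integrable setT (EFin \o Z) ->
  P.-integrable setT (EFin \o (fun w => X w * Z w)) /\
  \int[P]_w (X w * Z w) = \int[P]_w X w * \int[P]_w Z w.
Proof.
move=> mX mZ XZ iX iZ.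
pose X' : {mfun Omega >-> R} := mfun_Sub (mem_set mX).
pose Z' : {mfun Omega >-> R} := mfun_Sub (mem_set mZ).
have mXZ : measurable_fun setT (fun w => (X w, Z w)).
  exact: measurable_fun_pair.
pose XZ' : {mfun Omega >-> (R * R)%type} := mfun_Sub (mem_set mXZ).
pose PX : probability R R := distribution P X'.
pose PZ : probability R R := distribution P Z'.
have prodE (A : set (R * R)) : measurable A ->
    (PX \x PZ)%E A = distribution P XZ' A.
  apply: product_measure_unique => U V mU mV.
  by rewrite [LHS](_ : _ = P (X @^-1` U `&` Z @^-1` V))// XZ.
pose f (p : R * R) : R := p.1 * p.2.
have mf : measurable_fun setT f by exact: measurable_funM.
have iX' : PX.-integrable setT (EFin \o @idfun R).
  by apply: integrable_pushforward => //; apply/measurable_EFinP; exact: measurable_id.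
have iZ' : PZ.-integrable setT (EFin \o @idfun R).
  by apply: integrable_pushforward => //; apply/measurable_EFinP; exact: measurable_id.
have if' : (PX \x PZ)%E.-integrable setT (EFin \o f).
  apply/integrable12ltyP; first exact/measurable_EFinP.
  have mabs : measurable_fun [set: R] (fun x => (`|x|)%:E).
    by apply/measurable_EFinP; exact: normr_measurable.
  rewrite (eq_integral (fun x : R => (`|x|)%:E * \int[PZ]_y (`|y : R|)%:E)%E); last first.
    move=> x _; rewrite -ge0_integralZl//.
    by apply: eq_integral => y _; rewrite /= normrM EFinM.
  rewrite ge0_integralZr//; last exact: integral_ge0.
  apply: lte_mul_pinfty.
  - exact: integral_ge0.
  - rewrite ge0_fin_numE; last exact: integral_ge0.
    by have /integrableP[] := iX'.
  - by have /integrableP[] := iZ'.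
have ifXZ : P.-integrable setT (EFin \o (f \o (fun w => (X w, Z w)))).
  apply/integrableP; split.
    by apply/measurable_EFinP; exact: measurable_funM.
  have /integrableP[_] := if'.
  have -> : (\int[PX \x PZ]_p `|(EFin \o f) p| =
      \int[distribution P XZ']_p `|(EFin \o f) p|)%E.
    by apply: eq_measure_integral => A mA _; exact: prodE.
  rewrite ge0_integral_pushforward//.
  by apply: measurableT_comp => //; exact/measurable_EFinP.
split=> //.
have EX : \int[P]_w X w = \int[PX]_x x.
  rewrite /Rintegral; congr fine.
  by rewrite integral_pushforward//; exact/measurable_EFinP.
have EZ : \int[P]_w Z w = \int[PZ]_x x.
  rewrite /Rintegral; congr fine.
  by rewrite integral_pushforward//; exact/measurable_EFinP.
rewrite EX EZ -RintegralZr//.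
transitivity (fine (\int[PX \x PZ]_p (f p)%:E)%E).
  rewrite /Rintegral; congr fine.
  transitivity (\int[distribution P XZ']_p (f p)%:E)%E.
    by rewrite integral_pushforward//; exact/measurable_EFinP.
  by apply: eq_measure_integral => A mA _; exact/esym/prodE.
rewrite -(integral12_prod_meas1 if') /Rintegral; congr fine.
apply: eq_integral => x _; rewrite /fubini_F EFinM EFin_Rintegral//.
by rewrite -(integralZl measurableT iZ').
Qed.

End independence.

(** * Brownian increments *)

Section filtration.
Context {d : measure_display} {Omega : measurableType d} {R : realType}.
Variables (P : probability Omega R) (T : R) (Flt : R -> set (set Omega)).

Definition adapted (s : R) (f : Omega -> R) : Prop :=
  measurable_fun [set: g_sigma_algebraType (Flt s)]
    (f : g_sigma_algebraType (Flt s) -> R).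

Hypothesis hFlt : usual_filtration P T Flt.

Lemma adapted_set (s : R) (A : set Omega) : s \in `[0, T] ->
  (measurable (A : set (g_sigma_algebraType (Flt s))) : Prop) = Flt s A.
Proof.
move=> sT; rewrite /measurable/= sigma_algebra_id//.
exact: (flt_sigma_algebra hFlt).
Qed.

Lemma adapted_preimage (s : R) f (U : set R) : s \in `[0, T] ->
  adapted s f -> measurable U -> Flt s (f @^-1` U).
Proof.
move=> sT mf mU; rewrite -adapted_set// -[X in measurable X]setTI.
exact: mf.
Qed.

Lemma adapted_le (r s : R) f : 0 <= r -> r <= s -> s <= T ->
  adapted r f -> adapted s f.
Proof.
move=> r0 rs sT mf _ U mU; rewrite setTI adapted_set; last first.
  by rewrite in_itv/= sT (le_trans r0).
apply: (flt_mono hFlt r0 rs sT); apply: adapted_preimage => //.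
by rewrite in_itv/= r0 (le_trans rs).
Qed.

Lemma adapted_fun (s : R) f : s \in `[0, T] ->
  adapted s f -> measurable_fun setT f.
Proof.
move=> sT mf _ U mU; rewrite setTI; apply: (flt_measurable hFlt sT).
exact: adapted_preimage.
Qed.

End filtration.

Section brownian_increments.
Context {d : measure_display} {Omega : measurableType d} {R : realType}.
Variables (P : probability Omega R) (T : R) (Flt : R -> set (set Omega)).
Variables (dW : nat) (W : 'I_dW -> R -> Omega -> R).
Hypothesis hFlt : usual_filtration P T Flt.
Hypothesis hW : brownian_motion P T Flt W.
Local Notation adapted := (adapted Flt).

Lemma increment_refl (B : R -> Omega -> R) a w : increment B a a w = 0.
Proof. exact: subrr. Qed.

Lemma adapted_increment h a b : 0 <= a -> a <= b -> b <= T ->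
  adapted b (increment (W h) a b).
Proof.
move=> a0 ab bT; apply: measurable_funB.
  by apply: (bm_adapted hW); rewrite in_itv/= bT (le_trans a0).
apply: (adapted_le hFlt a0 ab bT).
by apply: (bm_adapted hW); rewrite in_itv/= a0 (le_trans ab).
Qed.

Lemma measurable_increment h a b : 0 <= a -> a <= b -> b <= T ->
  measurable_fun setT (increment (W h) a b).
Proof.
move=> a0 ab bT; apply: (@adapted_fun _ _ _ _ _ _ hFlt b).
  by rewrite in_itv/= bT (le_trans a0).
exact: adapted_increment.
Qed.

(** The trivial event is taken for all coordinates but [h]. *)
Lemma increment_indep h a b (A : set Omega) (V : set R) : 0 <= a -> a < b -> b <= T ->
  Flt a A -> measurable V ->
  (P (A `&` increment (W h) a b @^-1` V) =
   P A * P (increment (W h) a b @^-1` V))%E.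
Proof.
move=> a0 ab bT FA mV.
pose U h' : set R := if h' == h then V else setT.
have mU h' : measurable (U h') by rewrite /U; case: ifP.
have := bm_independent hW a0 ab bT FA mU.
rewrite (bigD1 h)//= big1 ?mule1; last first.
  by move=> h' /negbTE h'h; rewrite /U h'h preimage_setT probability_setT.
rewrite {2}/U eqxx => <-; congr (P (_ `&` _)); apply/seteqP; split => w /=.
- by move=> Vw h' _; rewrite /U; case: eqP => // ->.
- by move=> /(_ h I); rewrite /U eqxx.
Qed.

Let Pfin : (P setT < +oo)%E. Proof. by rewrite probability_setT ltry. Qed.

Lemma increment_moments h a b : 0 <= a -> a <= b -> b <= T ->
  [/\ square_integrable P setT (increment (W h) a b),
      \int[P]_w (increment (W h) a b w ^+ 2) = (b - a) * normal_moment2 &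
      \int[P]_w increment (W h) a b w = 0].
Proof.
move=> a0 ab bT; have [<-|a_neq_b] := eqVneq a b.
  rewrite (_ : increment _ _ _ = fun=> 0); last first.
    by apply/funext => w; exact: increment_refl.
  split; first exact: square_integrable0.
  - by rewrite expr0n/= Rintegral_cst// subrr !mul0r.
  - by rewrite Rintegral_cst// mul0r.
have lab : a < b by rewrite lt_neqAle a_neq_b.
have s0 : 0 < Num.sqrt (b - a) by rewrite sqrtr_gt0 subr_gt0.
have := normal_law_moments s0 (measurable_increment h a0 ab bT)
  (fun U mU => bm_normal hW h a0 lab bT mU).
by rewrite sqr_sqrtr// subr_ge0.
Qed.

(** A factor known at time [a] is independent of the increment over [a, b], so
    it can be averaged separately. *)
Lemma increment_orth h a b (Z : Omega -> R) : 0 <= a -> a <= b -> b <= T ->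
  adapted a Z -> P.-integrable setT (EFin \o Z) ->
  [/\ P.-integrable setT (EFin \o (fun w => Z w * increment (W h) a b w)),
      \int[P]_w (Z w * increment (W h) a b w) = 0,
      P.-integrable setT (EFin \o (fun w => Z w * increment (W h) a b w ^+ 2)) &
      \int[P]_w (Z w * increment (W h) a b w ^+ 2) =
        (b - a) * normal_moment2 * \int[P]_w Z w].
Proof.
move=> a0 ab bT aZ iZ.
have aT : a \in `[0, T] by rewrite in_itv/= a0 (le_trans ab).
have mZ := adapted_fun hFlt aT aZ.
have [sD D2 D1] := increment_moments h a0 ab bT.
have mD := measurable_increment h a0 ab bT.
have [iD _] := sqr_Rintegral_le measurableT Pfin sD.
have /square_integrableP[_ iD2] := sD.
have [abE|a_neq_b] := eqVneq a b.
  have D0 w : increment (W h) a b w = 0 by rewrite -abE increment_refl.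
  split.
  - under eq_fun do rewrite /= D0 mulr0; exact: integrable0.
  - by under eq_Rintegral do rewrite D0 mulr0; rewrite Rintegral_cst// mul0r.
  - under eq_fun do rewrite /= D0 expr0n mulr0; exact: integrable0.
  - under eq_Rintegral do rewrite D0 expr0n mulr0.
    by rewrite Rintegral_cst// -abE subrr !mul0r.
have lab : a < b by rewrite lt_neqAle a_neq_b.
have ind (U V : set R) : measurable U -> measurable V ->
    (P (Z @^-1` U `&` increment (W h) a b @^-1` V) =
     P (Z @^-1` U) * P (increment (W h) a b @^-1` V))%E.
  move=> mU mV; apply: increment_indep => //.
  exact: (adapted_preimage hFlt).
have [i1 E1] := Rintegral_indep_mul mZ mD ind iZ iD.
have ind2 (U V : set R) : measurable U -> measurable V ->
    (P (Z @^-1` U `&` (fun w => increment (W h) a b w ^+ 2)%R @^-1` V) =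
     P (Z @^-1` U) * P ((fun w => increment (W h) a b w ^+ 2)%R @^-1` V))%E.
  move=> mU mV; apply: (ind _ ((fun x => x ^+ 2) @^-1` V)) => //.
  by rewrite -[X in measurable X]setTI; exact: exprn_measurable.
have mD2 : measurable_fun setT (fun w => increment (W h) a b w ^+ 2).
  exact: measurable_funX.
have [i2 E2] := Rintegral_indep_mul mZ mD2 ind2 iZ iD2.
by split => //; rewrite ?E1 ?D1 ?mulr0// E2 D2 mulrC.
Qed.

End brownian_increments.

(** * The Ito isometry *)

Section ito_isometry.
Context {d : measure_display} {Omega : measurableType d} {R : realType}.
Variables (P : probability Omega R) (T : R) (Flt : R -> set (set Omega)).
Variables (dW : nat) (W : 'I_dW -> R -> Omega -> R).
Hypothesis hFlt : usual_filtration P T Flt.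
Hypothesis hW : brownian_motion P T Flt W.

Let Pfin : (P setT < +oo)%E. Proof. by rewrite probability_setT ltry. Qed.

Definition bounded_rv (f : Omega -> R) : Prop := exists M : R, forall w, `|f w| <= M.

Lemma bounded_rvM f g : bounded_rv f -> bounded_rv g -> bounded_rv (fun w => f w * g w).
Proof.
move=> [M fM] [M' gM']; exists (M * M') => w; rewrite normrM.
by rewrite ler_pM.
Qed.

Lemma integrable_bounded_mul f g : bounded_rv f -> measurable_fun setT f ->
  P.-integrable setT (EFin \o g) ->
  P.-integrable setT (EFin \o (fun w => f w * g w)).
Proof.
move=> [M fM] mf ig.
have mg : measurable_fun setT g by apply/measurable_EFinP; exact: measurable_int ig.
apply: (@le_integrable_real _ _ _ _ _ measurableT _ (fun w => M * `|g w|)).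
- exact: measurable_funM.
- by move=> w _; rewrite normrM ler_wpM2r.
- exact: (integrableZl measurableT M (integrable_norm ig)).
Qed.

Lemma bounded_rv_integrable f : bounded_rv f -> measurable_fun setT f ->
  P.-integrable setT (EFin \o f).
Proof.
move=> fM mf; rewrite (_ : f = fun w => f w * 1).
  apply: integrable_bounded_mul => //.
  exact: (@finite_measure_integrable_cst _ _ _ P setT 1).
by apply/funext => w; rewrite mulr1.
Qed.

Let null_integral (f : Omega -> R) :=
  P.-integrable setT (EFin \o f) /\ \int[P]_w f w = 0.

Let null_integralD f g : null_integral f -> null_integral g ->
  null_integral (fun w => f w + g w).
Proof.
move=> [fi f0] [gi g0]; split; first exact: (integrableD measurableT fi gi).
by rewrite RintegralD// f0 g0 addr0.
Qed.

Section ordered_pair.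
Variables (h : 'I_dW) (a b c e : R) (xi xi' : Omega -> R).
Hypotheses (a0 : 0 <= a) (ab : a <= b) (bT : b <= T) (ac : a <= c)
  (ce : c <= e) (eT : e <= T).
Hypotheses (axi : adapted Flt a xi) (axi' : adapted Flt c xi')
  (bxi : bounded_rv xi) (bxi' : bounded_rv xi').

Let c0 : 0 <= c. Proof. exact: le_trans ac. Qed.
Let cT : c <= T. Proof. exact: le_trans eT. Qed.
Let cIT : c \in `[0, T]. Proof. by rewrite in_itv/= c0. Qed.
Let aZ : adapted Flt c (fun w => xi w * xi' w).
Proof.
by apply: measurable_funM => //; exact: (adapted_le hFlt a0 ac cT axi).
Qed.
Let bZ : bounded_rv (fun w => xi w * xi' w). Proof. exact: bounded_rvM. Qed.
Let iZ : P.-integrable setT (EFin \o (fun w => xi w * xi' w)).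
Proof. by apply: bounded_rv_integrable => //; exact: (adapted_fun hFlt cIT). Qed.

(** Increments over disjoint intervals are uncorrelated, even when multiplied by
    a factor known at the start of the later one, so only the common part of
    ]a, b] and ]c, e] contributes: it is ]c, min b e], since [a <= c]. *)
Lemma ordered_increment_pair :
  \int[P]_w (xi w * increment (W h) a b w * (xi' w * increment (W h) c e w)) =
  normal_moment2 * (Num.max c (Num.min b e) - c) * \int[P]_w (xi w * xi' w).
Proof.
have [bc|cb] := leP b c.
  rewrite (max_idPl _); last by rewrite ge_min bc.
  rewrite subrr mulr0 mul0r.
  pose Z w := xi w * xi' w * increment (W h) a b w.
  have [sD _ _] := increment_moments hFlt hW h a0 ab bT.
  have [iD _] := sqr_Rintegral_le measurableT Pfin sD.
  have iZD : P.-integrable setT (EFin \o Z).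
    by apply: integrable_bounded_mul => //; exact: (adapted_fun hFlt cIT).
  have aZD : adapted Flt c Z.
    apply: measurable_funM => //.
    exact: (adapted_le hFlt (le_trans a0 ab) bc cT (adapted_increment hFlt hW h a0 ab bT)).
  have [_ <- _ _] := increment_orth hFlt hW h c0 ce eT aZD iZD.
  by apply: eq_Rintegral => w _; rewrite /Z; ring.
set m := Num.min b e.
have cm : c <= m by rewrite le_min (ltW cb) ce.
have mb : m <= b by rewrite ge_min lexx.
have me : m <= e by rewrite ge_min lexx orbT.
have mT : m <= T by exact: le_trans eT.
have m0 : 0 <= m by exact: le_trans cm.
rewrite (max_idPr cm).
(* ]a, b] is cut at c and m, ]c, e] at m; one of ]m, b] and ]m, e] is empty. *)
pose D x y w := increment (W h) x y w.
have mul_adapted x y z Z : 0 <= x -> x <= y -> y <= z -> z <= T ->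
    adapted Flt x Z -> bounded_rv Z ->
    adapted Flt z (fun w => Z w * D x y w) /\
    P.-integrable setT (EFin \o (fun w => Z w * D x y w)).
  move=> x0 xy yz zT aZ' bZ'; have yT := le_trans yz zT.
  have xT := le_trans xy yT; split.
    apply: measurable_funM; first exact: (adapted_le hFlt x0 (le_trans xy yz) zT aZ').
    apply: (adapted_le hFlt (le_trans x0 xy) yz zT).
    exact: (adapted_increment hFlt hW h x0 xy yT).
  have [sD _ _] := increment_moments hFlt hW h x0 xy yT.
  have [iD _] := sqr_Rintegral_le measurableT Pfin sD.
  apply: integrable_bounded_mul => //; apply: (adapted_fun hFlt _ aZ').
  by rewrite in_itv/= x0.
have null_mul x y Z : 0 <= x -> x <= y -> y <= T -> adapted Flt x Z ->
    P.-integrable setT (EFin \o Z) -> null_integral (fun w => Z w * D x y w).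
  move=> x0 xy yT aZ' iZ'.
  by have [? ? _ _] := increment_orth hFlt hW h x0 xy yT aZ' iZ'; split.
pose Z w := xi w * xi' w.
have [aZ1 iZ1] : adapted Flt c (fun w => Z w * D a c w) /\
    P.-integrable setT (EFin \o (fun w => Z w * D a c w)).
  have [aZ1 iZ1] := mul_adapted a c c xi a0 ac (lexx c) cT axi bxi.
  have -> : (fun w => Z w * D a c w) = (fun w => xi' w * (xi w * D a c w)).
    by apply/funext => w; rewrite /Z; ring.
  split; first exact: measurable_funM.
  by apply: integrable_bounded_mul => //; exact: (adapted_fun hFlt cIT).
have aZ1m : adapted Flt m (fun w => Z w * D a c w).
  exact: (adapted_le hFlt c0 cm mT aZ1).
have [aZ2 iZ2] := mul_adapted c m m Z c0 cm (lexx m) mT aZ bZ.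
have n1 := null_mul c m _ c0 cm mT aZ1 iZ1.
have n2 := null_mul m e _ m0 me eT aZ1m iZ1.
have n3 := null_mul m e _ m0 me eT aZ2 iZ2.
have n4 := null_mul m b _ m0 mb bT aZ2 iZ2.
have [_ _ i5 E5] := increment_orth hFlt hW h c0 cm mT aZ iZ.
have [in_ n0] := null_integralD n1 (null_integralD n2 (null_integralD n3 n4)).
transitivity (\int[P]_w (Z w * D c m w ^+ 2 +
    (Z w * D a c w * D c m w + (Z w * D a c w * D m e w +
      (Z w * D c m w * D m e w + Z w * D c m w * D m b w))))).
  apply: eq_Rintegral => w _.
  have -> : increment (W h) a b w = D a c w + D c m w + D m b w.
    by rewrite /D /increment; ring.
  have -> : increment (W h) c e w = D c m w + D m e w.
    by rewrite /D /increment; ring.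
  have D0 : D m b w * D m e w = 0.
    by rewrite /D /m /Num.min; case: ifP; rewrite increment_refl ?mulr0 ?mul0r.
  have : xi w * xi' w * (D m b w * D m e w) = 0 by rewrite D0 mulr0.
  by rewrite /Z; nra.
by rewrite RintegralD// n0 addr0 E5 [normal_moment2 * _]mulrC.
Qed.

(** The same quantity in terms of the integrands, which is the isometry for two
    single weighted increments. *)
Lemma ordered_indicator_pair lo hi : lo <= a -> e <= hi ->
  \int[time_prod P]_(p in strip lo hi)
    (xi p.2 * (a < p.1 <= b)%R%:R * (xi' p.2 * (c < p.1 <= e)%R%:R)) =
  (Num.max c (Num.min b e) - c) * \int[P]_w (xi w * xi' w).
Proof.
move=> loa ehi; set m := Num.max _ _; set f := fun p => _.
have mind x y : measurable_fun (strip lo hi)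
    (fun p : measurableTypeR R * Omega => (x < p.1 <= y)%R%:R : R).
  apply: (@measurable_time_fun _ _ _ _ _ (fun r => (x < r <= y)%R%:R)).
  have -> : (fun r : R => (x < r <= y)%R%:R : R) = \1_(`]x, y]).
    by apply/funext => r; rewrite indicE mem_setE in_itv.
  exact: measurable_indic.
have aIT : a \in `[0, T] by rewrite in_itv/= a0 (le_trans ab).
have mxi : measurable_fun setT xi by exact: (adapted_fun hFlt aIT).
have mxi' : measurable_fun setT xi' by exact: (adapted_fun hFlt cIT).
have mf : measurable_fun (strip lo hi) f.
  apply: measurable_funM; apply: measurable_funM => //;
    exact: measurable_omega_fun.
have fi : (time_prod P).-integrable (strip lo hi) (EFin \o f).
  have [M bM] := bxi; have [M' bM'] := bxi'.
  apply: (@le_integrable_real _ _ _ _ _ (measurable_strip lo hi) _ (fun=> M * M')) => //.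
    move=> p _; have ind1 (q : bool) : `|q%:R| <= 1 :> R by case: q; rewrite ?normr1 ?normr0.
    rewrite /f !normrM ler_pM ?mulr_ge0//.
      by rewrite -[leRHS]mulr1 ler_pM.
    by rewrite -[leRHS]mulr1 ler_pM.
  by apply: measurable_bounded_integrable; [exact: measurable_strip|exact: strip_finite|
    exact: measurable_cst|exact: bounded_cst].
have [_ _ <-] := strip_fubini fi.
rewrite -RintegralZl//; apply: eq_Rintegral => w _.
transitivity (\int[lebesgue_measure]_(r in `[lo, hi]) (xi w * xi' w * \1_(`]c, m]) r)).
  apply: eq_Rintegral => r _; rewrite /f indicE mem_setE in_itv/=.
  have -> : (c < r <= m)%R = (a < r <= b)%R && (c < r <= e)%R.
    rewrite /m; case: (ltP c r) => cr; rewrite ?andbF//= (le_lt_trans ac cr)/=.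
    by rewrite le_max le_min leNgt cr.
  by case: (a < r <= b)%R; case: (c < r <= e)%R => /=; ring.
have mI : measurable (`]c, m] : set (measurableTypeR R)) by exact: measurable_itv.
have mlh : measurable (`[lo, hi] : set (measurableTypeR R)) by exact: measurable_itv.
rewrite RintegralZl//; last first.
  exact: (integrableS measurableT mlh (@subsetT _ _) (integrable_indic_itv c m false false)).
rewrite mulrC; congr (_ * _); rewrite /Rintegral integral_indic//.
have cm : c <= m by rewrite le_max lexx.
rewrite setIidl; last first.
  move=> r /=; rewrite !in_itv/= => /andP[cr rm].
  rewrite (le_trans loa (le_trans ac (ltW cr)))/= (le_trans rm)// ge_max.
  by rewrite (le_trans ce ehi) ge_min ehi orbT.
suff : lebesgue_measure (`]c, m] : set R) = (m - c)%:E by move=> /(congr1 fine).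
rewrite lebesgue_measure_itv/= lte_fin; case: ltP => // mc.
by have -> : m = c; [apply/eqP; rewrite eq_le mc cm|rewrite subrr].
Qed.

End ordered_pair.

End ito_isometry.

Section weak_ito.
Context {d : measure_display} {Omega : measurableType d} {R : realType}.
Variables (P : probability Omega R) (T : R) (Flt : R -> set (set Omega)).
Variables (dW : nat) (W : 'I_dW -> R -> Omega -> R).
Hypothesis hFlt : usual_filtration P T Flt.
Hypothesis hW : brownian_motion P T Flt W.

(** One summand [xi 1_]a, b]] of a simple integrand.  The side conditions are part
    of the type, so that every list of atoms is a legitimate integrand and a sum
    of two integrands is a concatenation. *)
Record atom (lo hi : R) := Atom {
  atom_start : R ;
  atom_end : R ;
  atom_coef : Omega -> R ;
  atom_start_ge : lo <= atom_start ;
  atom_le : atom_start <= atom_end ;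
  atom_end_le : atom_end <= hi ;
  atom_adapted : adapted Flt atom_start atom_coef ;
  atom_bounded : bounded_rv atom_coef
}.

Arguments atom_adapted {lo hi} x : rename.

Definition atom_process lo hi (x : atom lo hi) (p : measurableTypeR R * Omega) : R :=
  atom_coef x p.2 * (atom_start x < p.1 <= atom_end x)%R%:R.

Definition atom_integral (B : R -> Omega -> R) lo hi (x : atom lo hi) (w : Omega) : R :=
  atom_coef x w * increment B (atom_start x) (atom_end x) w.

Definition step_process lo hi (l : seq (atom lo hi)) p : R :=
  \sum_(x <- l) atom_process x p.

Definition step_integral B lo hi (l : seq (atom lo hi)) w : R :=
  \sum_(x <- l) atom_integral B x w.

Definition scale_atom lo hi (a : R) (x : atom lo hi) : atom lo hi.
Proof.
apply: (@Atom lo hi (atom_start x) (atom_end x) (fun w => a * atom_coef x w)).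
- exact: atom_start_ge.
- exact: atom_le.
- exact: atom_end_le.
- by apply: measurable_funM => //; exact: atom_adapted.
- have [M xM] := atom_bounded x; exists (`|a| * M) => w.
  by rewrite normrM ler_wpM2l.
Defined.

Lemma step_process_lin lo hi a (l l' : seq (atom lo hi)) p :
  step_process (map (scale_atom a) l ++ l') p = a * step_process l p + step_process l' p.
Proof.
rewrite /step_process big_cat big_map mulr_sumr; congr (_ + _).
by apply: eq_bigr => x _; rewrite /atom_process/= mulrA.
Qed.

Lemma step_integral_lin B lo hi a (l l' : seq (atom lo hi)) w :
  step_integral B (map (scale_atom a) l ++ l') w =
  a * step_integral B l w + step_integral B l' w.
Proof.
rewrite /step_integral big_cat big_map mulr_sumr; congr (_ + _).
by apply: eq_bigr => x _; rewrite /atom_integral/= mulrA.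
Qed.

Section interval.
Variables (h : 'I_dW) (lo hi : R).
Hypotheses (lo0 : 0 <= lo) (hiT : hi <= T).
Implicit Types (x y : atom lo hi) (l : seq (atom lo hi)).

Let Pfin : (P setT < +oo)%E. Proof. by rewrite probability_setT ltry. Qed.
Let mstrip := @measurable_strip _ Omega R lo hi.
Let start0 x : 0 <= atom_start x. Proof. exact: le_trans (atom_start_ge x). Qed.
Let endT x : atom_end x <= T. Proof. exact: le_trans (atom_end_le x) hiT. Qed.
Let startIT x : atom_start x \in `[0, T].
Proof. by rewrite in_itv/= start0 (le_trans (atom_le x)). Qed.

Lemma measurable_atom_coef x : measurable_fun setT (atom_coef x).
Proof. exact: (adapted_fun hFlt (startIT x) (atom_adapted x)). Qed.

Lemma square_integrable_atom_process x :
  square_integrable (time_prod P) (strip lo hi) (atom_process x).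
Proof.
have [M xM] := atom_bounded x.
have mx : measurable_fun (strip lo hi) (atom_process x).
  apply: measurable_funM; first exact: measurable_omega_fun (measurable_atom_coef x).
  apply: (@measurable_time_fun _ _ _ _ _
    (fun r => (atom_start x < r <= atom_end x)%R%:R)).
  have -> : (fun r : R => (atom_start x < r <= atom_end x)%R%:R : R) =
      \1_(`]atom_start x, atom_end x]).
    by apply/funext => r; rewrite indicE mem_setE in_itv.
  exact: measurable_indic.
apply/square_integrableP; split => //.
apply: (@le_integrable_real _ _ _ _ _ mstrip _ (fun=> M ^+ 2)) => //.
- exact: measurable_funX.
- move=> p _; rewrite normrX ler_sqr ?nnegrE//; last exact: le_trans (xM p.2).
  rewrite /atom_process normrM -[leRHS]mulr1 ler_pM//.
  by case: (_ && _); rewrite ?normr1 ?normr0.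
- by apply: measurable_bounded_integrable; [exact: measurable_strip|exact: strip_finite|
    exact: measurable_cst|exact: bounded_cst].
Qed.

Lemma square_integrable_atom_integral x :
  square_integrable P setT (atom_integral (W h) x).
Proof.
have [M xM] := atom_bounded x.
have [sD _ _] := increment_moments hFlt hW h (start0 x) (atom_le x) (endT x).
apply: (@square_integrable_ae_bounded _ _ _ _ _ measurableT _ M _ _ _ sD).1.
- exact: measurable_atom_coef.
- by apply: aeW => w _; exact: xM.
Qed.

Lemma square_integrable_step_process l :
  square_integrable (time_prod P) (strip lo hi) (step_process l).
Proof.
by apply: square_integrable_sum => // x; exact: square_integrable_atom_process.
Qed.

Lemma square_integrable_step_integral l :
  square_integrable P setT (step_integral (W h) l).
Proof.
by apply: square_integrable_sum => // x; exact: square_integrable_atom_integral.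
Qed.

Lemma atom_isometry x y :
  \int[P]_w (atom_integral (W h) x w * atom_integral (W h) y w) =
  normal_moment2 *
    \int[time_prod P]_(p in strip lo hi) (atom_process x p * atom_process y p).
Proof.
wlog xy : x y / atom_start x <= atom_start y.
  move=> wl; have [/wl//|/ltW /wl yx] := leP (atom_start x) (atom_start y).
  under eq_Rintegral do rewrite mulrC.
  by under [in RHS]eq_Rintegral do rewrite mulrC.
rewrite (ordered_increment_pair hFlt hW h (start0 x) (atom_le x) (endT x) xy
  (atom_le y) (endT y) (atom_adapted x) (atom_adapted y)
  (atom_bounded x) (atom_bounded y)).
rewrite (ordered_indicator_pair hFlt (start0 x) (atom_le x) (endT x) xy
  (atom_le y) (endT y) (atom_adapted x) (atom_adapted y)
  (atom_bounded x) (atom_bounded y) (atom_start_ge x) (atom_end_le y)).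
by rewrite mulrA.
Qed.

(** Both sides are quadratic in the list of atoms, so the case of pairs of atoms
    suffices. *)
Lemma step_isometry l :
  \int[P]_w (step_integral (W h) l w ^+ 2) =
  normal_moment2 * \int[time_prod P]_(p in strip lo hi) (step_process l p ^+ 2).
Proof.
have sqrE (S : Type) (f : atom lo hi -> S -> R) p :
    (\sum_(x <- l) f x p) ^+ 2 = \sum_(x <- l) \sum_(y <- l) f x p * f y p.
  by rewrite expr2 mulr_suml; apply: eq_bigr => x _; rewrite mulr_sumr.
under eq_Rintegral do rewrite sqrE.
under [in RHS]eq_Rintegral do rewrite sqrE.
have i1 x y : P.-integrable setT
    (EFin \o (fun w => atom_integral (W h) x w * atom_integral (W h) y w)).
  by apply: square_integrable_mul => //; exact: square_integrable_atom_integral.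
have i2 x y : (time_prod P).-integrable (strip lo hi)
    (EFin \o (fun p => atom_process x p * atom_process y p)).
  by apply: square_integrable_mul => //; exact: square_integrable_atom_process.
rewrite !Rintegral_sum//; first last.
- by move=> x; exact: integrable_sum_real.
- by move=> x; exact: integrable_sum_real.
rewrite mulr_sumr; apply: eq_bigr => x _; rewrite !Rintegral_sum// mulr_sumr.
by apply: eq_bigr => y _; exact: atom_isometry.
Qed.

(** Approximation by finite sums of weighted increments over arbitrary,
    possibly overlapping, intervals: such sums can be added without passing to
    a common subdivision. *)
Definition weak_ito (H : measurableTypeR R * Omega -> R) (I : Omega -> R) : Prop :=
  measurable_fun setT I /\
  forall eps : R, 0 < eps -> exists l,
    (\int[time_prod P]_(p in strip lo hi) ((step_process l p - H p) ^+ 2)%:E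
       < eps%:E)%E /\
    (\int[P]_w ((step_integral (W h) l w - I w) ^+ 2)%:E < eps%:E)%E.


Lemma weak_ito_of_ito (H : R -> Omega -> R) I :
  measurable_fun (strip lo hi) (fun p : measurableTypeR R * Omega => H p.1 p.2) ->
  is_ito_integral P Flt (W h) lo hi H I ->
  weak_ito (fun p => H p.1 p.2) I.
Proof.
move=> mH [mI [m [tau [xi [simple_n cvgH cvgI]]]]]; split => // eps eps0.
have cvg0_lt (u : (\bar R)^nat) : u @ \oo --> 0%E -> \forall n \near \oo, (u n < eps%:E)%E.
  move=> u0; apply: (u0 [set x | (x < eps%:E)%E]).
  by apply: open_nbhs_nbhs; split; [exact: open_ereal_lt_ereal|rewrite /= lte_fin].
have [n [ltH ltI]] : exists n,
   (\int[P]_w \int[lebesgue_measure]_(r in `[lo, hi])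
     ((simple_process (m n) (tau n) (xi n) r w - H r w) ^+ 2)%:E < eps%:E)%E /\
   (\int[P]_w ((simple_integral (W h) (m n) (tau n) (xi n) w - I w) ^+ 2)%:E < eps%:E)%E.
  near \oo => n; exists n; split; near: n; exact: cvg0_lt.
have [tau_lo tau_hi tau_mono xi_adapted [M xiM]] := simple_n n.
have tau_ge j : (j <= m n)%N -> lo <= tau n j.
  elim: j => // j ih jm; apply: (le_trans (ih (ltnW jm))).
  exact: tau_mono.
have tau_le j : (j <= m n)%N -> tau n j <= hi.
  move=> /subnK; move: (m n - j)%N => k; elim: k j => [|k ih] j.
    by rewrite add0n => ->.
  rewrite addSnnS => jm; apply: (le_trans (tau_mono _ _)); last exact: ih.
  by rewrite -jm addnS ltnS leq_addl.
have [l [lp li]] : exists l : seq (atom lo hi),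
    (forall p, step_process l p = simple_process (m n) (tau n) (xi n) p.1 p.2) /\
    (forall w, step_integral (W h) l w = simple_integral (W h) (m n) (tau n) (xi n) w).
  suff partial k : (k <= m n)%N -> exists l : seq (atom lo hi),
      (forall p, step_process l p = simple_process k (tau n) (xi n) p.1 p.2) /\
      (forall w, step_integral (W h) l w = simple_integral (W h) k (tau n) (xi n) w).
    exact: partial.
  rewrite /simple_process /simple_integral; elim: k => [_|j ih jm].
    by exists [::]; split => [p|w]; rewrite /step_process /step_integral !big_nil big_ord0.
  have [l [lp li]] := ih (ltnW jm).
  have bj : bounded_rv (xi n j) by exists M => w; exact: xiM.
  pose x := Atom (tau_ge j (ltnW jm)) (tau_mono j jm) (tau_le j.+1 jm) (xi_adapted j jm) bj.
  exists (x :: l); split => [p|w]; rewrite big_ord_recr/= addrC.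
    by rewrite -lp /step_process big_cons.
  by rewrite -li /step_integral big_cons.
exists l; split; last by under eq_integral do rewrite li.
have [ml _] := square_integrable_step_process l.
have mlH : measurable_fun (strip lo hi) (fun p => (step_process l p - H p.1 p.2) ^+ 2).
  by apply: measurable_funX; exact: measurable_funB.
rewrite -(strip_tonelli P mlH (fun _ _ => sqr_ge0 _)).1; move: ltH.
congr (_ < _)%E; apply: eq_integral => w _; apply: eq_integral => r _.
by rewrite lp.
Unshelve. all: by end_near. Qed.

Lemma weak_ito_lin a (H H' : measurableTypeR R * Omega -> R) I I' :
  measurable_fun (strip lo hi) H -> measurable_fun (strip lo hi) H' ->
  weak_ito H I -> weak_ito H' I' ->
  weak_ito (fun p => a * H p + H' p) (fun w => a * I w + I' w).
Proof.
move=> mH mH' [mI HI] [mI' HI']; split.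
  by apply: measurable_funD => //; exact: measurable_funM.
move=> eps eps0; set del := eps / (2 * (a ^+ 2 + 1)).
have a1 : 0 < a ^+ 2 + 1 by rewrite ltr_wpDl ?sqr_ge0.
have del0 : 0 < del by rewrite divr_gt0// mulr_gt0.
have [l [lH lI]] := HI _ del0; have [l' [lH' lI']] := HI' _ del0.
have small (u v : R) : u < del -> v < del -> 2 * (a ^+ 2 * u + v) < eps.
  move=> ud vd; have -> : eps = 2 * (a ^+ 2 * del + del).
    by rewrite /del; field; rewrite gt_eqF.
  by rewrite ltr_pM2l// ler_ltD// ler_wpM2l ?sqr_ge0// ltW.
have [ml _] := square_integrable_step_process l.
have [ml' _] := square_integrable_step_process l'.
have [mi _] := square_integrable_step_integral l.
have [mi' _] := square_integrable_step_integral l'.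
exists (map (scale_atom a) l ++ l'); split.
- have m1 : measurable_fun (strip lo hi) (fun p => step_process l p - H p).
    exact: measurable_funB.
  have m2 : measurable_fun (strip lo hi) (fun p => step_process l' p - H' p).
    exact: measurable_funB.
  have /(sqr_integral_ltP _ mstrip _ m1)[s1 d1] := lH.
  have /(sqr_integral_ltP _ mstrip _ m2)[s2 d2] := lH'.
  have E : (fun p => step_process (map (scale_atom a) l ++ l') p - (a * H p + H' p)) =
      (fun p => a * (step_process l p - H p) + (step_process l' p - H' p)).
    by apply/funext => p; rewrite step_process_lin; ring.
  have s12 := square_integrableD mstrip (square_integrableZ mstrip a s1) s2.
  under eq_integral do rewrite [X in X ^+ 2](congr1 (@^~ _) E).
  apply/sqr_integral_ltP; [exact: mstrip|exact: s12.1|split => //].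
  exact: le_lt_trans (Rintegral_sqrD_le mstrip a s1 s2) (small _ _ d1 d2).
- have m1 : measurable_fun setT (fun w => step_integral (W h) l w - I w).
    exact: measurable_funB.
  have m2 : measurable_fun setT (fun w => step_integral (W h) l' w - I' w).
    exact: measurable_funB.
  have /(sqr_integral_ltP _ measurableT _ m1)[s1 d1] := lI.
  have /(sqr_integral_ltP _ measurableT _ m2)[s2 d2] := lI'.
  have E : (fun w => step_integral (W h) (map (scale_atom a) l ++ l') w - (a * I w + I' w)) =
      (fun w => a * (step_integral (W h) l w - I w) + (step_integral (W h) l' w - I' w)).
    by apply/funext => w; rewrite step_integral_lin; ring.
  have s12 := square_integrableD measurableT (square_integrableZ measurableT a s1) s2.
  under eq_integral do rewrite [X in X ^+ 2](congr1 (@^~ _) E).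
  apply/sqr_integral_ltP; [exact: measurableT|exact: s12.1|split => //].
  exact: le_lt_trans (Rintegral_sqrD_le measurableT a s1 s2) (small _ _ d1 d2).
Qed.

(** Replacing [I] by a step integral and the step process by [H] costs a factor 2
    each time, whence the factor 4 in front of the isometry. *)
Lemma weak_ito_bound (H : measurableTypeR R * Omega -> R) I :
  square_integrable (time_prod P) (strip lo hi) H -> weak_ito H I ->
  square_integrable P setT I /\
  \int[P]_w (I w ^+ 2) <=
    4 * normal_moment2 * \int[time_prod P]_(p in strip lo hi) (H p ^+ 2).
Proof.
move=> sH [mI HI].
set q := \int[time_prod P]_(p in strip lo hi) _; set c := @normal_moment2 R.
have c0 : 0 <= c by apply: Rintegral_ge0 => x _; exact: sqr_ge0.
have approx eps : 0 < eps -> square_integrable P setT I /\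
    \int[P]_w (I w ^+ 2) <= 2 * eps + 4 * c * eps + 4 * c * q.
  move=> eps0; have [l [lH lI]] := HI _ eps0.
  have sl := square_integrable_step_process l.
  have si := square_integrable_step_integral l.
  have m1 : measurable_fun (strip lo hi) (fun p => step_process l p - H p).
    by apply: measurable_funB => //; [exact: sl.1|exact: sH.1].
  have m2 : measurable_fun setT (fun w => step_integral (W h) l w - I w).
    by apply: measurable_funB => //; exact: si.1.
  have /(sqr_integral_ltP _ mstrip _ m1)[s1 d1] := lH.
  have /(sqr_integral_ltP _ measurableT _ m2)[s2 d2] := lI.
  have IE : I = (fun w => -1 * (step_integral (W h) l w - I w) + step_integral (W h) l w).
    by apply/funext => w; ring.
  split.
    rewrite IE; apply: square_integrableD => //.
    exact: square_integrableZ.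
  have le1 : \int[P]_w (I w ^+ 2) <=
      2 * ((-1) ^+ 2 * \int[P]_w ((step_integral (W h) l w - I w) ^+ 2) +
           c * \int[time_prod P]_(p in strip lo hi) (step_process l p ^+ 2)).
    rewrite -step_isometry; apply: le_trans (Rintegral_sqrD_le measurableT (-1) s2 si).
    by rewrite le_eqVlt; apply/orP; left; apply/eqP; apply: eq_Rintegral => w _; ring.
  have le2 : \int[time_prod P]_(p in strip lo hi) (step_process l p ^+ 2) <=
      2 * (1 ^+ 2 * \int[time_prod P]_(p in strip lo hi) ((step_process l p - H p) ^+ 2) + q).
    apply: le_trans (Rintegral_sqrD_le mstrip 1 s1 sH).
    by rewrite le_eqVlt; apply/orP; left; apply/eqP; apply: eq_Rintegral => p _; ring.
  move: le1 le2 d1 d2 c0; rewrite -/c.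
  move: (\int[P]_w I w ^+ 2) (\int[P]_w (step_integral (W h) l w - I w) ^+ 2) => u v.
  move: (\int[time_prod P]_(p in strip lo hi) step_process l p ^+ 2)
    (\int[time_prod P]_(p in strip lo hi) (step_process l p - H p) ^+ 2) => s r.
  move=> le1 le2 re ve c0.
  have : c * s <= c * (2 * eps + 2 * q) by rewrite ler_wpM2l//; nra.
  by nra.
split; first by have [] := approx 1 ltr01.
apply/ler_addgt0Pr => e e0; pose eps := e / (2 + 4 * c).
have k0 : 0 < 2 + 4 * c by nra.
have [_ le_eps] := approx eps (divr_gt0 e0 k0).
apply: (le_trans le_eps); rewrite addrC lerD2l -mulrDl.
by rewrite /eps mulrC divfK ?gt_eqF.
Qed.

End interval.
End weak_ito.

(** * A Gronwall lemma *)

Section gronwall.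
Context {R : realType}.
Local Notation mu := (@lebesgue_measure R).

(** Once the integral vanishes up to [u], the bound makes the integral up to
    [u + 1 / (2 K)] at most half of itself, hence zero; finitely many such steps
    reach [T]. *)
Lemma gronwall_eq0 (phi : R -> \bar R) (t T K : R) : t <= T -> 0 <= K ->
  measurable_fun `[t, T] phi -> (forall s, (0 <= phi s)%E) ->
  (\int[mu]_(s in `[t, T]) phi s < +oo)%E ->
  (forall s, s \in `[t, T] -> (phi s <= K%:E * \int[mu]_(r in `[t, s]) phi r)%E) ->
  (\int[mu]_(s in `[t, T]) phi s = 0)%E.
Proof.
move=> tT K0 mphi phi0 phifin phi_le.
have mitv a b c e : measurable ([set` Interval (BSide a b) (BSide c e)] : set (measurableTypeR R)).
  exact: measurable_itv.
have sub_itv s : s <= T -> `[t, s] `<=` `[t, T].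
  by move=> sT r /=; rewrite !in_itv/= => /andP[-> /le_trans ->].
have mphiS s : s <= T -> measurable_fun `[t, s] phi.
  by move=> sT; apply: (measurable_funS _ (sub_itv _ sT)) => //; exact: mitv.
have step u s : t <= u -> u <= s -> s <= T -> K * (s - u) <= 2^-1 ->
    (\int[mu]_(r in `[t, u]) phi r = 0 -> \int[mu]_(r in `[t, s]) phi r = 0)%E.
  move=> tu us sT Ksu u0.
  set J := (\int[mu]_(r in `[t, s]) phi r)%E.
  have J0 : (0 <= J)%E by exact: integral_ge0.
  have Jfin : J \is a fin_num.
    rewrite ge0_fin_numE//; apply: le_lt_trans phifin.
    by apply: ge0_subset_integral => //; exact: sub_itv.
  have Jle : (J <= (K * (s - u))%:E * J)%E.
    rewrite {1}/J (@itv_bndbnd_setU _ _ (BLeft t) (BRight u) (BRight s))//.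
    have disj : [disjoint `[t, u]%classic & `]u, s]%classic].
      rewrite disj_set2E; apply/eqP; rewrite -subset0 => r [/=].
      by rewrite !in_itv/= => /andP[_ ru] /andP[/lt_le_trans/(_ ru)]; rewrite ltxx.
    have mU : measurable_fun (`[t, u] `|` `]u, s]) phi.
      by rewrite -itv_bndbnd_setU//; exact: mphiS.
    rewrite (ge0_integral_setU mu (mitv true t false u) (mitv false u false s) mU
      (fun r _ => phi0 r) disj).
    rewrite u0 add0e.
    apply: (@le_trans _ _ (\int[mu]_(r in `]u, s]) (cst (K%:E * J) r))%E).
      apply: ge0_le_integral => //.
      - apply: (measurable_funS (mitv true t false s) _ (mphiS s sT)).
        by move=> r /=; rewrite !in_itv/= => /andP[ur ->]; rewrite (le_trans tu (ltW ur)).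
      - move=> r /=; rewrite in_itv/= => /andP[ur rs].
        have tr := le_trans tu (ltW ur).
        apply: (le_trans (phi_le r _)).
          by rewrite in_itv/= tr (le_trans rs sT).
        apply: lee_wpmul2l; first by rewrite lee_fin.
        apply: ge0_subset_integral => //; first exact: mphiS.
        by move=> x /=; rewrite !in_itv/= => /andP[-> /le_trans ->].
    rewrite (integral_cst mu (mitv false u false s)).
    have mu_us : mu `]u, s] = (s - u)%:E.
      rewrite lebesgue_measure_itv/= lte_fin; case: ltP => // su.
      by have -> : u = s; [apply/eqP; rewrite eq_le us su|rewrite subrr].
    rewrite [X in (_ * X)%E](mu_us : _ = _) -(fineK Jfin) -!EFinM lee_fin; lra.
  rewrite -(fineK Jfin); congr EFin.
  move: Jle J0; rewrite -(fineK Jfin) -EFinM !lee_fin; nra.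
pose n := Num.bound (2 * K * (T - t)).
have n_gt : 2 * K * (T - t) < n.+1%:R.
  apply: (lt_trans (y := n%:R)); last by rewrite ltr_nat.
  by apply: archi_boundP; rewrite !mulr_ge0// subr_ge0.
pose a j : R := t + (T - t) * (j%:R / n.+1%:R).
have a_le j : a j <= a j.+1.
  by rewrite lerD2l ler_wpM2l ?subr_ge0// ler_pM2r ?invr_gt0// ler_nat.
have ta j : t <= a j by rewrite lerDl mulr_ge0 ?subr_ge0 ?divr_ge0.
have aT j : (j <= n.+1)%N -> a j <= T.
  move=> jn; rewrite -lerBrDl -[leRHS]mulr1 ler_wpM2l ?subr_ge0//.
  by rewrite ler_pdivrMr// mul1r ler_nat.
have all0 j : (j <= n.+1)%N -> (\int[mu]_(r in `[t, (a j)]) phi r = 0)%E.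
  elim: j => [_|j ih jn].
    by rewrite /a mul0r mulr0 addr0 set_itv1 integral_set1.
  apply: (step (a j)) => //; [exact: aT|..|exact: ih (ltnW jn)].
  have -> : a j.+1 - a j = (T - t) / n.+1%:R.
    by rewrite /a -natr1; ring.
  rewrite mulrA ler_pdivrMr//; lra.
by have := all0 n.+1 (leqnn _); rewrite /a divff ?pnatr_eq0// mulr1 addrC subrK.
Qed.

End gronwall.

(** * Square-integrable processes and bounded coefficients *)

Section strip_L2.
Context {d : measure_display} {Omega : measurableType d} {R : realType}.
Variable P : probability Omega R.
Local Notation prod := (time_prod P).

(** The constant is the same on all strips, which is what Gronwall's lemma
    requires. *)
Lemma Linfty_strip_mul (T : R) (c : R -> R) : Linfty T c ->
  exists2 M : R, 0 <= M & forall a b f, 0 <= a -> b <= T ->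
    square_integrable prod (strip a b) f ->
    square_integrable prod (strip a b) (fun p => c p.1 * f p) /\
    \int[prod]_(p in strip a b) (c p.1 * f p) ^+ 2 <=
      M * \int[prod]_(p in strip a b) (f p) ^+ 2.
Proof.
move=> [mc [M [N [mN N0 NM]]]]; exists (M ^+ 2); first exact: sqr_ge0.
move=> a b f a0 bT sf.
have sub : `[a, b] `<=` `[0, T].
  move=> r /=; rewrite !in_itv/= => /andP[ar rb].
  by rewrite (le_trans a0 ar) (le_trans rb bT).
have mc' : measurable_fun `[a, b] c.
  by apply: (measurable_funS _ sub mc); exact: measurable_itv.
apply: square_integrable_ae_bounded => //.
- exact: measurable_strip.
- exact: measurable_time_fun.
exists (N `*` [set: Omega]); split.
- exact: measurableX.
- have -> : prod (N `*` [set: Omega]) = (lebesgue_measure N * P setT)%E.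
    exact: (product_measure1E lebesgue_measure P).
  by rewrite [X in (X * _)%E](N0 : _ = _) mul0e.
- move=> [s w] /= /not_implyP[[sab _] /negP cM]; split => //; apply: NM => /= h.
  by apply: (negP cM); apply: h; have := sub _ sab.
Qed.

Lemma L2_strip (T : R) (f : R -> R) a b : L2 T f -> 0 <= a -> b <= T ->
  square_integrable prod (strip a b) (fun p => f p.1).
Proof.
move=> [mf f2] a0 bT.
have sub : `[a, b] `<=` `[0, T].
  move=> r /=; rewrite !in_itv/= => /andP[ar rb].
  by rewrite (le_trans a0 ar) (le_trans rb bT).
have mf' : measurable_fun `[a, b] f.
  by apply: (measurable_funS _ sub mf); exact: measurable_itv.
have ms : measurable_fun (strip a b) (fun p : measurableTypeR R * Omega => f p.1).
  exact: measurable_time_fun.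
split => //; have m2 := measurable_funX 2 ms.
rewrite -(strip_tonelli P m2 (fun _ _ => sqr_ge0 _)).2; apply: le_lt_trans f2.
apply: (@le_trans _ _ (\int[lebesgue_measure]_(s in `[a, b]) (f s ^+ 2)%:E)%E).
  rewrite le_eqVlt; apply/orP; left; apply/eqP; apply: eq_integral => s _.
  transitivity ((f s ^+ 2)%:E * P setT)%E.
    exact: (integral_cst P measurableT (f s ^+ 2)%:E).
  by rewrite probability_setT mule1.
apply: ge0_subset_integral => //.
- by apply/measurable_EFinP; exact: measurable_funX.
- by move=> r _; rewrite lee_fin sqr_ge0.
Qed.

(** The Cauchy-Schwarz inequality on almost every path. *)
Lemma square_integrable_time_integral a b f : a <= b ->
  square_integrable prod (strip a b) f ->
  square_integrable P setT
    (fun w => \int[lebesgue_measure]_(r in `[a, b]) f (r, w)) /\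
  \int[P]_w (\int[lebesgue_measure]_(r in `[a, b]) f (r, w)) ^+ 2 <=
    (b - a) * \int[prod]_(p in strip a b) (f p) ^+ 2.
Proof.
move=> ab sf; have mS := @measurable_strip _ Omega R a b.
have [fi _] := sqr_Rintegral_le mS (strip_finite P a b) sf.
have /square_integrableP[mf f2i] := sf.
have [_ Fi _] := strip_fubini fi.
have [ae2 F2i E2] := strip_fubini f2i.
set F := fun w => \int[lebesgue_measure]_(r in `[a, b]) f (r, w).
set F2 := fun w => \int[lebesgue_measure]_(r in `[a, b]) (f (r, w) ^+ 2).
have mF : measurable_fun setT F by apply/measurable_EFinP; exact: measurable_int Fi.
have mF2 : measurable_fun setT F2 by apply/measurable_EFinP; exact: measurable_int F2i.
have mab : measurable (`[a, b] : set (measurableTypeR R)) by exact: measurable_itv.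
have lenE : lebesgue_measure (`[a, b] : set R) = (b - a)%:E.
  rewrite lebesgue_measure_itv/= lte_fin; case: ltP => // ba.
  by have -> : a = b; [apply/eqP; rewrite eq_le ab ba|rewrite subrr].
have le_int : (\int[P]_w (F w ^+ 2)%:E <= \int[P]_w ((b - a) * F2 w)%:E)%E.
  apply: ae_ge0_le_integral => //.
  - by move=> w _; rewrite lee_fin sqr_ge0.
  - by apply/measurable_EFinP; exact: measurable_funX.
  - move=> w _; rewrite lee_fin mulr_ge0 ?subr_ge0// Rintegral_ge0// => r _.
    exact: sqr_ge0.
  - by apply/measurable_EFinP; exact: measurable_funM.
  move: ae2; apply: filterS => w f2w _; rewrite lee_fin.
  have sw : square_integrable (lebesgue_measure : {measure set (measurableTypeR R) -> \bar R})
      `[a, b] (fun r => f (r, w)).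
    apply/square_integrableP; split => //.
    exact: measurable_path_section mf.
  have lenfin : (lebesgue_measure (`[a, b] : set R) < +oo)%E by rewrite lenE ltry.
  have [_] := sqr_Rintegral_le mab lenfin sw.
  by rewrite [X in fine X](lenE : _ = _).
have bF2i : P.-integrable setT (EFin \o (fun w => (b - a) * F2 w)).
  exact: (integrableZl measurableT (b - a) F2i).
have sF : square_integrable P setT F.
  split => //; apply: (le_lt_trans le_int).
  by rewrite -EFin_Rintegral// ltry.
split => //; rewrite -E2 -/F2 -RintegralZl// -lee_fin !EFin_Rintegral//.
by have /square_integrableP[] := sF.
Qed.

Definition sq_process a b m (v : @process d Omega R m) : Prop :=
  forall j, square_integrable prod (strip a b) (fun p => v p.1 p.2 j 0).

Definition sq_norm a b m (v : @process d Omega R m) : R :=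
  \sum_j \int[prod]_(p in strip a b) (v p.1 p.2 j 0) ^+ 2.

Lemma sq_process_lin a b m (k : R) (v v' : @process d Omega R m) :
  sq_process a b v -> sq_process a b v' ->
  sq_process a b (fun s w => k *: v s w + v' s w).
Proof.
move=> sv sv' j; under eq_fun do rewrite !mxE.
have mS := @measurable_strip _ Omega R a b.
by apply: square_integrableD => //; exact: square_integrableZ.
Qed.

Lemma sq_process0 a b m : sq_process a b (fun _ _ => 0 : 'cV[R]_m).
Proof. by move=> j; under eq_fun do rewrite mxE; exact: square_integrable0. Qed.

Lemma sq_process_sub a b a' b' m (v : @process d Omega R m) :
  a' <= a -> b <= b' -> sq_process a' b' v -> sq_process a b v.
Proof.
move=> aa bb sv j; have [mv v2] := sv j.
have mS := @measurable_strip _ Omega R a b.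
have sub := @strip_subset _ Omega R a b a' b' aa bb.
have mv' : measurable_fun (strip a b) (fun p => v p.1 p.2 j 0).
  exact: (measurable_funS (measurable_strip a' b') sub mv).
split => //; apply: le_lt_trans v2; apply: ge0_subset_integral => //.
- exact: measurable_strip.
- by apply/measurable_EFinP; exact: measurable_funX.
- by move=> p _; rewrite lee_fin sqr_ge0.
Qed.

Lemma Linfty_mx_strip_mul (T : R) m1 m2 (A : R -> 'M[R]_(m1, m2)) : Linfty_mx T A ->
  exists2 M : R, 0 <= M & forall a b (v : @process d Omega R m2), 0 <= a -> b <= T ->
    sq_process a b v ->
    sq_process a b (fun s w => A s *m v s w) /\
    forall i, \int[prod]_(p in strip a b) ((A p.1 *m v p.1 p.2) i 0) ^+ 2 <=
      M * sq_norm a b v.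
Proof.
move=> LA.
pose bounded_by i j (M : R) := 0 <= M /\ forall a b f, 0 <= a -> b <= T ->
    square_integrable prod (strip a b) f ->
    square_integrable prod (strip a b) (fun p => A p.1 i j * f p) /\
    \int[prod]_(p in strip a b) (A p.1 i j * f p) ^+ 2 <=
      M * \int[prod]_(p in strip a b) (f p) ^+ 2.
have bound i j : exists M : R, bounded_by i j M.
  by have [M M0 MP] := Linfty_strip_mul (LA i j); exists M.
have bound_row i : exists Mi : 'I_m2 -> R, forall j, bounded_by i j (Mi j).
  exact: fin_all_exists (bound i).
have [M MP] := fin_all_exists bound_row.
have M0 i j : 0 <= M i j by have [] := MP i j.
have sum0 : 0 <= \sum_i \sum_j M i j by do 2! apply: sumr_ge0 => ? _.
exists (2 ^+ size (index_enum 'I_m2) * \sum_i \sum_j M i j).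
  by rewrite mulr_ge0.
move=> a b v a0 bT sv; have mS := @measurable_strip _ Omega R a b.
have entry i p : (A p.1 *m v p.1 p.2) i 0 = \sum_j A p.1 i j * v p.1 p.2 j 0.
  by rewrite mxE.
have si i j : square_integrable prod (strip a b) (fun p => A p.1 i j * v p.1 p.2 j 0).
  by have [_ MPij] := MP i j; exact: (MPij a b _ a0 bT (sv j)).1.
split => i.
  by under eq_fun do rewrite entry; exact: square_integrable_sum.
under eq_Rintegral do rewrite entry.
apply: (le_trans (Rintegral_sqr_sum_le mS _ (si i))).
rewrite -mulrA ler_wpM2l ?exprn_ge0// /sq_norm mulr_sumr; apply: ler_sum => j _.
have [_ MPij] := MP i j; apply: (le_trans (MPij a b _ a0 bT (sv j)).2).
rewrite ler_wpM2r//; first by apply: Rintegral_ge0 => p _; exact: sqr_ge0.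
rewrite (bigD1 i)//= (bigD1 j)//= -addrA lerDl addr_ge0//.
  by apply: sumr_ge0.
by apply: sumr_ge0 => i' _; apply: sumr_ge0.
Qed.

End strip_L2.

(** * Linear stochastic differential equations *)

Section H2_processes.
Context {d : measure_display} {Omega : measurableType d} {R : realType}.
Variables (P : probability Omega R) (T t : R) (Flt : R -> set (set Omega)).
Hypotheses (hFlt : usual_filtration P T Flt) (ht : 0 <= t) (htT : t <= T).

(** Progressive measurability at the final time is joint measurability, the
    final sigma-algebra being contained in that of the whole space. *)
Lemma progressive_measurable m (v : @process d Omega R m) j :
  progressive T Flt t v -> measurable_fun (strip t T) (fun p => v p.1 p.2 j 0).
Proof.
move=> pv.
have TtT : T \in `[t, T] by rewrite in_itv/= htT lexx.
have T0T : T \in `[0, T] by rewrite in_itv/= lexx (le_trans ht).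
pose idF (w : Omega) : g_sigma_algebraType (Flt T) := w.
have mid : measurable_fun setT idF.
  move=> _ A mA; rewrite setTI; apply: (flt_measurable hFlt T0T).
  by rewrite -(adapted_set hFlt).
pose F (p : measurableTypeR R * Omega) : measurableTypeR R * g_sigma_algebraType (Flt T) :=
  (p.1, idF p.2).
have mF : measurable_fun setT F.
  by apply: measurable_fun_pair => //; exact: measurableT_comp.
apply: (@measurable_comp _ _ _ _ _ _ (`[t, T] `*` [set: g_sigma_algebraType (Flt T)]) _
  (strip t T) F) (pv T j TtT) _ => //.
- by apply: measurableX => //; exact: measurable_itv.
- by move=> _ [[s w] [sT _] <-].
- exact: measurable_funTS.
Qed.

Lemma sq_process_of_H2 m (v : @process d Omega R m) :
  H2 P T Flt t v -> sq_process P t T v.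
Proof.
move=> [pv v2] j; have mv i := progressive_measurable i pv.
split; first exact: mv.
have msum : measurable_fun (strip t T)
    (fun p : measurableTypeR R * Omega => \sum_(i < m) (v p.1 p.2 i 0) ^+ 2).
  by apply: measurable_sum => i; exact: measurable_funX.
have sum0 p : 0 <= \sum_(i < m) (v p.1 p.2 i 0) ^+ 2.
  by apply: sumr_ge0 => i _; exact: sqr_ge0.
have := strip_tonelli P msum (fun p _ => sum0 p); case=> E _.
apply: le_lt_trans v2; rewrite E; apply: ge0_le_integral => //.
- exact: measurable_strip.
- by move=> p _; rewrite lee_fin sqr_ge0.
- by apply/measurable_EFinP; exact: measurable_funX.
- exact/measurable_EFinP.
- move=> p _; rewrite lee_fin (bigD1 j)//= lerDl.
  by apply: sumr_ge0 => i _; exact: sqr_ge0.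
Qed.

End H2_processes.

Section linear_field.
Context {d : measure_display} {Omega : measurableType d} {R : realType} {n K : nat}.
Variable P : probability Omega R.

(** The weight [beta] of the inhomogeneous term is 1 in the state equation and 0
    in the variational equations; with it the field is linear in
    [(beta, U, Z)]. *)
Definition lin_field (A : R -> 'M[R]_n) (B : R -> 'M[R]_(n, K)) (b : R -> 'cV[R]_n)
    (beta : R) (U : @process d Omega R K) (Z : @process d Omega R n) :
    @process d Omega R n :=
  fun s w => A s *m Z s w + B s *m U s w + beta *: b s.

Lemma lin_field_lin A B b k beta beta' (U U' : @process d Omega R K)
    (Z Z' : @process d Omega R n) s w :
  lin_field A B b (k * beta + beta') (fun s w => k *: U s w + U' s w)
    (fun s w => k *: Z s w + Z' s w) s w =
  k *: lin_field A B b beta U Z s w + lin_field A B b beta' U' Z' s w.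
Proof.
rewrite /lin_field !mulmxDr -!scalemxAr !scalerDl !scalerDr !scalerA.
by rewrite (addrACA (k *: (A s *m Z s w))) [LHS]addrACA.
Qed.

Lemma sq_lin_field (T : R) A B b beta U Z lo hi :
  Linfty_mx T A -> Linfty_mx T B -> L2_mx T b -> 0 <= lo -> hi <= T ->
  sq_process P lo hi U -> sq_process P lo hi Z ->
  sq_process P lo hi (lin_field A B b beta U Z).
Proof.
move=> LA LB Lb lo0 hiT sU sZ j.
have mS := @measurable_strip _ Omega R lo hi.
have [MA _ /(_ lo hi Z lo0 hiT sZ)[sA _]] := Linfty_mx_strip_mul P LA.
have [MB _ /(_ lo hi U lo0 hiT sU)[sB _]] := Linfty_mx_strip_mul P LB.
under eq_fun do rewrite /lin_field mxE [X in _ + X]mxE [X in X + _]mxE.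
apply: square_integrableD => //.
  by apply: square_integrableD => //.
by apply: square_integrableZ => //; exact: (L2_strip P (Lb j 0) lo0 hiT).
Qed.

End linear_field.

Section weak_solution.
Context {d : measure_display} {Omega : measurableType d} {R : realType}.
Context {n K dW : nat}.
Variables (P : probability Omega R) (T t : R) (Flt : R -> set (set Omega)).
Variable W : 'I_dW -> R -> Omega -> R.
Hypotheses (hFlt : usual_filtration P T Flt) (hW : brownian_motion P T Flt W).
Hypotheses (ht : 0 <= t) (htT : t <= T).
Variables (A : R -> 'M[R]_n) (B : R -> 'M[R]_(n, K)) (b : R -> 'cV[R]_n).
Variables (C : 'I_dW -> R -> 'M[R]_n) (D : 'I_dW -> R -> 'M[R]_(n, K))
  (sigma : 'I_dW -> R -> 'cV[R]_n).
Hypotheses (LA : Linfty_mx T A) (LB : Linfty_mx T B) (Lb : L2_mx T b).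
Hypotheses (LC : forall h, Linfty_mx T (C h)) (LD : forall h, Linfty_mx T (D h))
  (Lsigma : forall h, L2_mx T (sigma h)).
Implicit Types (z : 'cV[R]_n) (beta : R) (U : @process d Omega R K)
  (Z : @process d Omega R n).

(** [solves_sde] for the fields [lin_field], with the Ito integrals relaxed to
    [weak_ito]: in this form linear combinations of solutions are solutions. *)
Definition weak_solution z beta U Z : Prop :=
  sq_process P t T Z /\
  forall s, s \in `[t, T] -> exists I : 'I_dW -> 'I_n -> Omega -> R,
    (forall h j, weak_ito P Flt W h t s
       (fun p => lin_field (C h) (D h) (sigma h) beta U Z p.1 p.2 j 0) (I h j)) /\
    {ae P, forall w, forall j, Z s w j 0 = z j 0
       + \int[lebesgue_measure]_(r in `[t, s]) lin_field A B b beta U Z r w j 0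
       + \sum_(h < dW) I h j w}.

Let sq_drift s beta U Z : s <= T -> sq_process P t T U -> sq_process P t T Z ->
  sq_process P t s (lin_field A B b beta U Z).
Proof.
move=> sT sU sZ; apply: (@sq_lin_field _ _ _ _ _ P T) => //;
  exact: sq_process_sub (lexx t) sT _.
Qed.

Let sq_diffusion h s beta U Z : s <= T -> sq_process P t T U -> sq_process P t T Z ->
  sq_process P t s (lin_field (C h) (D h) (sigma h) beta U Z).
Proof.
move=> sT sU sZ; apply: (@sq_lin_field _ _ _ _ _ P T) => //;
  exact: sq_process_sub (lexx t) sT _.
Qed.

Lemma weak_solution_of_sde z beta U Z f g : sq_process P t T U ->
  (forall s w, f s w (Z s w) = lin_field A B b beta U Z s w) ->
  (forall h s w, g h s w (Z s w) = lin_field (C h) (D h) (sigma h) beta U Z s w) ->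
  solves_sde P T Flt W t z f g Z -> weak_solution z beta U Z.
Proof.
move=> sU fE gE [HZ _ solZ]; have sZ := sq_process_of_H2 hFlt ht htT HZ.
split => // s stT; have [I [ItoI eqZ]] := solZ s stT.
have /andP[ts sT] : t <= s <= T by move: stT; rewrite in_itv.
exists (fun h j w => I h w j 0); split => [h j|].
  apply: (weak_ito_of_ito hFlt ht sT
    (H := fun r w => lin_field (C h) (D h) (sigma h) beta U Z r w j 0)).
    exact: (sq_diffusion h beta sT sU sZ j).1.
  have := ItoI h j; congr is_ito_integral.
  by apply/funext => r; apply/funext => w; rewrite gE.
move: eqZ; apply: filterS => w eqZ j; rewrite eqZ.
by congr (_ + _ + _); apply: eq_Rintegral => r _; rewrite fE.
Qed.

Lemma weak_solution_lin k z z' beta beta' U U' Z Z' :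
  sq_process P t T U -> sq_process P t T U' ->
  weak_solution z beta U Z -> weak_solution z' beta' U' Z' ->
  weak_solution (k *: z + z') (k * beta + beta')
    (fun s w => k *: U s w + U' s w) (fun s w => k *: Z s w + Z' s w).
Proof.
move=> sU sU' [sZ solZ] [sZ' solZ']; split; first exact: sq_process_lin.
move=> s stT; have [I [wI eqZ]] := solZ s stT; have [I' [wI' eqZ']] := solZ' s stT.
have /andP[ts sT] : t <= s <= T by move: stT; rewrite in_itv.
exists (fun h j w => k * I h j w + I' h j w); split => [h j|].
  rewrite (_ : (fun p => _) = (fun p : measurableTypeR R * Omega =>
      k * lin_field (C h) (D h) (sigma h) beta U Z p.1 p.2 j 0 +
      lin_field (C h) (D h) (sigma h) beta' U' Z' p.1 p.2 j 0)); last first.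
    by apply/funext => p; rewrite lin_field_lin !mxE.
  apply: (weak_ito_lin hFlt hW ht sT) => //.
  - exact: (sq_diffusion h beta sT sU sZ j).1.
  - exact: (sq_diffusion h beta' sT sU' sZ' j).1.
have path_int beta1 U1 Z1 : sq_process P t T U1 -> sq_process P t T Z1 ->
    {ae P, forall w, forall j, lebesgue_measure.-integrable `[t, s]
      (EFin \o (fun r => lin_field A B b beta1 U1 Z1 r w j 0))}.
  move=> sU1 sZ1; apply: filter_forall => j.
  have [fi _] := sqr_Rintegral_le (measurable_strip t s) (strip_finite P t s)
    (sq_drift beta1 sT sU1 sZ1 j).
  by have [] := strip_fubini fi.
have mts : measurable (`[t, s] : set (measurableTypeR R)) by exact: measurable_itv.
have path_ints : {ae P, forall w, forall j,
    lebesgue_measure.-integrable `[t, s]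
      (EFin \o (fun r => lin_field A B b beta U Z r w j 0)) /\
    lebesgue_measure.-integrable `[t, s]
      (EFin \o (fun r => lin_field A B b beta' U' Z' r w j 0))}.
  move: (path_int beta U Z sU sZ) (path_int beta' U' Z' sU' sZ').
  by apply: filterS2 => w iw iw' j; split.
move: eqZ eqZ' path_ints; apply: filterS3 => w eqZ eqZ' iws j.
have [iw iw'] := iws j; rewrite !mxE eqZ eqZ'.
have -> : \int[lebesgue_measure]_(r in `[t, s])
    lin_field A B b (k * beta + beta') (fun s w => k *: U s w + U' s w)
      (fun s w => k *: Z s w + Z' s w) r w j 0 =
    k * \int[lebesgue_measure]_(r in `[t, s]) lin_field A B b beta U Z r w j 0 +
    \int[lebesgue_measure]_(r in `[t, s]) lin_field A B b beta' U' Z' r w j 0.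
  rewrite -(RintegralZl k mts iw) -RintegralD//; last first.
    exact: (integrableZl mts k iw).
  by apply: eq_Rintegral => r _; rewrite lin_field_lin !mxE.
by rewrite big_split/= -mulr_sumr; ring.
Qed.

(** Cauchy-Schwarz for the drift and the isometry for the noise. *)
Lemma weak_solution_moment z beta U Z s j : sq_process P t T U ->
  weak_solution z beta U Z -> s \in `[t, T] ->
  square_integrable P setT (fun w => Z s w j 0) /\
  \int[P]_w (Z s w j 0) ^+ 2 <= 2 * (z j 0 ^+ 2 + 2 *
    ((T - t) * \int[time_prod P]_(p in strip t s)
                 (lin_field A B b beta U Z p.1 p.2 j 0) ^+ 2 +
     2 ^+ size (index_enum 'I_dW) * \sum_(h < dW) (4 * normal_moment2 *
       \int[time_prod P]_(p in strip t s)
         (lin_field (C h) (D h) (sigma h) beta U Z p.1 p.2 j 0) ^+ 2))).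
Proof.
move=> sU [sZ solZ] stT; have [I [wI eqZ]] := solZ s stT.
have /andP[ts sT] : t <= s <= T by move: stT; rewrite in_itv.
have [sY Yle] := square_integrable_time_integral ts (sq_drift beta sT sU sZ j).
have sI h := (weak_ito_bound hFlt hW ht sT (sq_diffusion h beta sT sU sZ j) (wI h j)).
set Y := fun w => \int[lebesgue_measure]_(r in `[t, s]) _ in sY Yle.
have sS : square_integrable P setT (fun w => \sum_(h < dW) I h j w).
  by apply: square_integrable_sum => // h; exact: (sI h).1.
have sYS := square_integrableD measurableT (square_integrableZ measurableT 1 sY) sS.
have Pfin : (P setT < +oo)%E by rewrite probability_setT ltry.
have sz : square_integrable P setT (fun=> z j 0).
  apply/square_integrableP; split => //.
  by apply: measurable_bounded_integrable => //; exact: bounded_cst.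
have sV := square_integrableD measurableT (square_integrableZ measurableT 1 sz) sYS.
have mZ : measurable_fun setT (fun w => Z s w j 0).
  exact: (measurable_time_section stT (sZ j).1).
have aeE : ae_eq P setT (fun w => ((Z s w j 0) ^+ 2)%:E)
    (fun w => ((1 * z j 0 + (1 * Y w + \sum_(h < dW) I h j w)) ^+ 2)%:E).
  by move: eqZ; apply: filterS => w /(_ j) -> _; rewrite !mul1r addrA.
have intE : (\int[P]_w ((Z s w j 0) ^+ 2)%:E =
    \int[P]_w ((1 * z j 0 + (1 * Y w + \sum_(h < dW) I h j w)) ^+ 2)%:E)%E.
  apply: ae_eq_integral => //; apply/measurable_EFinP; apply: measurable_funX => //.
  exact: sV.1.
split; first by split => //; rewrite intE; exact: sV.2.
rewrite [leLHS](congr1 fine intE).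
apply: (le_trans (Rintegral_sqrD_le measurableT 1 sz sYS)).
rewrite ler_pM2l// expr1n mul1r lerD//.
  by rewrite Rintegral_cst// [X in fine X](probability_setT P : _ = _) mulr1.
apply: (le_trans (Rintegral_sqrD_le measurableT 1 sY sS)).
rewrite ler_pM2l// expr1n mul1r lerD//.
  apply: (le_trans Yle); rewrite ler_wpM2r ?lerB//.
  by apply: Rintegral_ge0 => p _; exact: sqr_ge0.
apply: (le_trans (Rintegral_sqr_sum_le measurableT _ (fun h => (sI h).1))).
by rewrite ler_wpM2l ?exprn_ge0//; apply: ler_sum => h _; exact: (sI h).2.
Qed.

(** By the moment estimate with [z = 0], [U = 0] and [beta = 0], the second moment
    at time [s] is at most a constant times its integral over [t, s]. *)
Lemma weak_solution_unique Z : weak_solution 0 0 (fun _ _ => 0) Z ->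
  forall s, s \in `[t, T] -> {ae P, forall w, Z s w = 0}.
Proof.
move=> wZ; have sU : sq_process P t T (fun _ _ => 0 : 'cV[R]_K) by exact: sq_process0.
have [sZ _] := wZ.
have fieldE (A1 : R -> 'M[R]_n) (B1 : R -> 'M[R]_(n, K)) b1 s w :
    lin_field A1 B1 b1 0 (fun _ _ => 0) Z s w = A1 s *m Z s w.
  by rewrite /lin_field mulmx0 scale0r !addr0.
have [MA MA0 MAP] := Linfty_mx_strip_mul P LA.
have [MC MCP] : exists MC : 'I_dW -> R, forall h, 0 <= MC h /\
    forall a c (v : @process d Omega R n), 0 <= a -> c <= T -> sq_process P a c v ->
    sq_process P a c (fun s w => C h s *m v s w) /\
    forall i, \int[time_prod P]_(p in strip a c) ((C h p.1 *m v p.1 p.2) i 0) ^+ 2 <=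
      MC h * sq_norm P a c v.
  apply: (fin_all_exists (P := fun h MCh => 0 <= MCh /\
    forall a c (v : @process d Omega R n), 0 <= a -> c <= T -> sq_process P a c v ->
    sq_process P a c (fun s w => C h s *m v s w) /\
    forall i, \int[time_prod P]_(p in strip a c) ((C h p.1 *m v p.1 p.2) i 0) ^+ 2 <=
      MCh * sq_norm P a c v)) => h.
  by have [M M0 MP] := Linfty_mx_strip_mul P (LC h); exists M.
have c0 : 0 <= @normal_moment2 R by apply: Rintegral_ge0 => x _; exact: sqr_ge0.
pose kap := 2 * (2 * ((T - t) * MA + 2 ^+ size (index_enum 'I_dW) *
  \sum_(h < dW) (4 * normal_moment2 * MC h))).
have kap0 : 0 <= kap.
  rewrite !mulr_ge0// addr_ge0 ?mulr_ge0 ?subr_ge0 ?exprn_ge0//.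
  by apply: sumr_ge0 => h _; rewrite !mulr_ge0//; case: (MCP h).
have mom s j : s \in `[t, T] -> square_integrable P setT (fun w => Z s w j 0) /\
    \int[P]_w (Z s w j 0) ^+ 2 <= kap * sq_norm P t s Z.
  move=> stT; have /andP[ts sT] : t <= s <= T by move: stT; rewrite in_itv.
  have sZs := sq_process_sub (lexx t) sT sZ.
  have [sZj le_mom] := weak_solution_moment j sU wZ stT; split => //.
  apply: (le_trans le_mom); rewrite mxE expr0n add0r /kap -!mulrA ler_pM2l// ler_pM2l//.
  rewrite [leRHS]mulrDl lerD//.
    under eq_Rintegral do rewrite fieldE.
    by rewrite -mulrA ler_wpM2l ?subr_ge0//; exact: (MAP t s Z ht sT sZs).2.
  rewrite -mulrA ler_wpM2l ?exprn_ge0// mulr_suml; apply: ler_sum => h _.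
  under eq_Rintegral do rewrite fieldE.
  rewrite -!mulrA ler_pM2l// ler_wpM2l//.
  by have [_ /(_ t s Z ht sT sZs)[_]] := MCP h.
pose g (p : measurableTypeR R * Omega) := \sum_j (Z p.1 p.2 j 0) ^+ 2.
have g0 p : 0 <= g p by apply: sumr_ge0 => j _; exact: sqr_ge0.
have mg s : s <= T -> measurable_fun (strip t s) g.
  move=> sT; apply: measurable_sum => j; apply: measurable_funX.
  exact: (sq_process_sub (lexx t) sT sZ j).1.
pose phi s := (\int[P]_w (g (s, w))%:E)%E.
have phi_int s : s <= T ->
    (\int[lebesgue_measure]_(r in `[t, s]) phi r = (sq_norm P t s Z)%:E)%E.
  move=> sT; rewrite (strip_tonelli P (mg s sT) (fun p _ => g0 p)).2.
  have iZ2 j : (time_prod P).-integrable (strip t s)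
      (EFin \o (fun p => (Z p.1 p.2 j 0) ^+ 2)).
    by have /square_integrableP[] := sq_process_sub (lexx t) sT sZ j.
  rewrite -EFin_Rintegral ?Rintegral_sum//; first exact: measurable_strip.
  - exact: measurable_strip.
  - by apply: integrable_sum_real => //; exact: measurable_strip.
have phi_le s : s \in `[t, T] -> (phi s <= (n%:R * kap)%:E *
    \int[lebesgue_measure]_(r in `[t, s]) phi r)%E.
  move=> stT; have /andP[ts sT] : t <= s <= T by move: stT; rewrite in_itv.
  have iZ2 j : P.-integrable setT (EFin \o (fun w => (Z s w j 0) ^+ 2)).
    by have [/square_integrableP[]] := mom s j stT.
  rewrite phi_int// /phi -EFin_Rintegral//; last exact: integrable_sum_real.
  rewrite -EFinM lee_fin Rintegral_sum//.
  apply: (le_trans (ler_sum _ (fun j _ => (mom s j stT).2))).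
  by rewrite sumr_const card_ord -[leRHS]mulrA [leRHS]mulr_natl.
have nsq0 : (\int[lebesgue_measure]_(r in `[t, T]) phi r = 0)%E.
  apply: (gronwall_eq0 (K := n%:R * kap)) => //.
  - by rewrite mulr_ge0.
  - exact: (strip_tonelli_measurable P (mg T (lexx T)) (fun p _ => g0 p)).
  - by move=> s; apply: integral_ge0 => w _; rewrite lee_fin.
  - by rewrite phi_int// ltry.
move=> s stT; have /andP[ts sT] : t <= s <= T by move: stT; rewrite in_itv.
have mgs : measurable_fun setT (fun w => g (s, w)).
  exact: (measurable_time_section stT (mg T (lexx T))).
have phis0 : phi s = 0%E.
  apply/eqP; rewrite eq_le integral_ge0 ?andbT; last by move=> w _; rewrite lee_fin.
  apply: (le_trans (phi_le s stT)).
  rewrite (_ : (\int[_]_(r in _) _)%E = 0%E) ?mule0//.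
  apply/eqP; rewrite eq_le integral_ge0 ?andbT; last first.
    by move=> r _; apply: integral_ge0 => w _; rewrite lee_fin.
  rewrite -nsq0; apply: ge0_subset_integral => //.
  - exact: (strip_tonelli_measurable P (mg T (lexx T)) (fun p _ => g0 p)).
  - by move=> r _; apply: integral_ge0 => w _; rewrite lee_fin.
  - by move=> r /=; rewrite !in_itv/= => /andP[-> /le_trans ->].
have : ae_eq P setT (fun w => (g (s, w))%:E) (cst 0%E).
  apply/ae_eq_integral_abs => //; first exact/measurable_EFinP.
  rewrite -[RHS]phis0; apply: eq_integral => w _.
  by rewrite gee0_abs// lee_fin.
apply: filterS => w /(_ I) /= [] /eqP; rewrite psumr_eq0; last first.
  by move=> j _; exact: sqr_ge0.
move=> /allP zero; apply/matrixP => j i; rewrite ord1 mxE.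
by have := zero j (mem_index_enum j); rewrite /= sqrf_eq0 => /eqP.
Qed.

End weak_solution.

(** * Quadratic functionals of a state and a control *)

Section dot_product.
Context {R : realType}.

Lemma dotmxE m (x y : 'cV[R]_m) : dotmx x y = \sum_j x j 0 * y j 0.
Proof. by rewrite /dotmx mxE; apply: eq_bigr => j _; rewrite mxE. Qed.

Lemma dotmxC m (x y : 'cV[R]_m) : dotmx x y = dotmx y x.
Proof. by rewrite !dotmxE; apply: eq_bigr => j _; rewrite mulrC. Qed.

Lemma dotmxDr m (x y z : 'cV[R]_m) : dotmx x (y + z) = dotmx x y + dotmx x z.
Proof. by rewrite /dotmx mulmxDr mxE. Qed.

Lemma dotmxZr m a (x y : 'cV[R]_m) : dotmx x (a *: y) = a * dotmx x y.
Proof. by rewrite /dotmx -scalemxAr mxE. Qed.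

Lemma dotmx_linr m a (x y z : 'cV[R]_m) :
  dotmx x (a *: y + z) = a * dotmx x y + dotmx x z.
Proof. by rewrite dotmxDr dotmxZr. Qed.

Lemma dotmx_linl m a (x y z : 'cV[R]_m) :
  dotmx (a *: y + z) x = a * dotmx y x + dotmx z x.
Proof. by rewrite dotmxC dotmx_linr !(dotmxC x). Qed.

Lemma dotmx_mulr m1 m2 (x : 'cV[R]_m1) (A : 'M[R]_(m1, m2)) (y : 'cV[R]_m2) :
  dotmx x (A *m y) = dotmx y (A^T *m x).
Proof. by rewrite dotmxC /dotmx trmx_mul !mulmxA. Qed.

Lemma mulmx_lin m1 m2 (A : 'M[R]_(m1, m2)) a (x y : 'cV[R]_m2) :
  A *m (a *: x + y) = a *: (A *m x) + A *m y.
Proof. by rewrite mulmxDr -scalemxAr. Qed.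

Lemma integrable_dotmx (d : measure_display) (S : measurableType d)
    (mu : {measure set S -> \bar R}) (D : set S) m (v v' : S -> 'cV[R]_m) :
  measurable D ->
  (forall j, square_integrable mu D (fun x => v x j 0)) ->
  (forall j, square_integrable mu D (fun x => v' x j 0)) ->
  mu.-integrable D (EFin \o (fun x => dotmx (v x) (v' x))).
Proof.
move=> mD sv sv'; under [X in _ \o X]eq_fun do rewrite dotmxE.
by apply: integrable_sum_real => // j; exact: square_integrable_mul.
Qed.

End dot_product.

Section running_plus_terminal.
Context {d : measure_display} {Omega : measurableType d} {R : realType}.
Variable P : probability Omega R.

Lemma Rintegral_running_terminal t T (f : measurableTypeR R * Omega -> R) (k : Omega -> R) :
  (time_prod P).-integrable (strip t T) (EFin \o f) ->
  P.-integrable setT (EFin \o k) ->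
  P.-integrable setT
    (EFin \o (fun w => \int[lebesgue_measure]_(s in `[t, T]) f (s, w) + k w)) /\
  \int[P]_w (\int[lebesgue_measure]_(s in `[t, T]) f (s, w) + k w) =
    \int[time_prod P]_(x in strip t T) f x + \int[P]_w k w.
Proof.
move=> fi ki; have [_ Fi <-] := strip_fubini fi.
by split; [exact: (integrableD measurableT Fi ki)|rewrite RintegralD].
Qed.

End running_plus_terminal.

Section quadratic_functional.
Context {d : measure_display} {Omega : measurableType d} {R : realType} {n K : nat}.
Variables (P : probability Omega R) (T t : R).
Hypotheses (ht : 0 <= t) (htT : t <= T).
Variables (Q : R -> 'M[R]_n) (Rm : R -> 'M[R]_K) (S : R -> 'M[R]_(n, K))
  (q : R -> 'cV[R]_n) (rho : R -> 'cV[R]_K) (G : 'M[R]_n) (g : 'cV[R]_n).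
Hypotheses (LQ : Linfty_mx T Q) (LR : Linfty_mx T Rm) (LS : Linfty_mx T S)
  (Lq : L2_mx T q) (Lrho : L2_mx T rho).
Hypotheses (symQ : forall s, s \in `[0, T] -> (Q s)^T = Q s)
  (symR : forall s, s \in `[0, T] -> (Rm s)^T = Rm s) (symG : G^T = G).

Definition path_pair : Type := (@process d Omega R n * @process d Omega R K)%type.

Definition pair_lin (a : R) (p p' : path_pair) : path_pair :=
  (fun s w => a *: p.1 s w + p'.1 s w, fun s w => a *: p.2 s w + p'.2 s w).

Definition admissible (p : path_pair) : Prop :=
  [/\ sq_process P t T p.1, sq_process P t T p.2 &
      forall j, square_integrable P setT (fun w => p.1 T w j 0)].

(** The exceptional event may depend on the time. *)
Definition modification (p p' : path_pair) : Prop :=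
  forall s, s \in `[t, T] ->
    {ae P, forall w, p.1 s w = p'.1 s w /\ p.2 s w = p'.2 s w}.

Lemma admissible_lin a p p' : admissible p -> admissible p' ->
  admissible (pair_lin a p p').
Proof.
move=> [p1 p2 p3] [p1' p2' p3']; split; [exact: sq_process_lin|exact: sq_process_lin|].
move=> j /=; under eq_fun do rewrite !mxE.
by apply: square_integrableD => //; exact: square_integrableZ.
Qed.

(** The polarization of the quadratic part of the running cost. *)
Definition running_bilin s (z : 'cV[R]_n) (u : 'cV[R]_K) (z' : 'cV[R]_n) (u' : 'cV[R]_K) : R :=
  dotmx z' (Q s *m z) + dotmx u' (Rm s *m u) + dotmx z (S s *m u') + dotmx z' (S s *m u).

Definition running_lin s (z : 'cV[R]_n) (u : 'cV[R]_K) : R :=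
  dotmx (q s) z + dotmx (rho s) u.

Definition bilin_integrand (p p' : path_pair) (x : measurableTypeR R * Omega) : R :=
  running_bilin x.1 (p.1 x.1 x.2) (p.2 x.1 x.2) (p'.1 x.1 x.2) (p'.2 x.1 x.2).

Definition lin_integrand (p : path_pair) (x : measurableTypeR R * Omega) : R :=
  running_lin x.1 (p.1 x.1 x.2) (p.2 x.1 x.2).

Definition bilin_cost (p p' : path_pair) : R :=
  \int[time_prod P]_(x in strip t T) bilin_integrand p p' x +
  \int[P]_w dotmx (p'.1 T w) (G *m p.1 T w).

Definition lin_cost (p : path_pair) : R :=
  \int[time_prod P]_(x in strip t T) lin_integrand p x +
  \int[P]_w dotmx g (p.1 T w).

Let mS := @measurable_strip _ Omega R t T.
Let Pfin : (P setT < +oo)%E. Proof. by rewrite probability_setT ltry. Qed.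
Let tIT : T \in `[t, T]. Proof. by rewrite in_itv/= htT lexx. Qed.

Lemma integrable_bilin_integrand p p' : admissible p -> admissible p' ->
  (time_prod P).-integrable (strip t T) (EFin \o bilin_integrand p p').
Proof.
move=> [p1 p2 _] [p1' p2' _].
have mulA m1 m2 (M : R -> 'M[R]_(m1, m2)) (v : @process d Omega R m2) :
    Linfty_mx T M -> sq_process P t T v -> sq_process P t T (fun s w => M s *m v s w).
  by move=> LM sv; have [Mb _ /(_ t T v ht (lexx T) sv)[]] := Linfty_mx_strip_mul P LM.
have dotA m (v v' : @process d Omega R m) : sq_process P t T v -> sq_process P t T v' ->
    (time_prod P).-integrable (strip t T)
      (EFin \o (fun x => dotmx (v x.1 x.2) (v' x.1 x.2))).
  by move=> sv sv'; exact: integrable_dotmx.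
have i1 := dotA _ _ _ p1' (mulA _ _ Q _ LQ p1).
have i2 := dotA _ _ _ p2' (mulA _ _ Rm _ LR p2).
have i3 := dotA _ _ _ p1 (mulA _ _ S _ LS p2').
have i4 := dotA _ _ _ p1' (mulA _ _ S _ LS p2).
exact: (integrableD mS (integrableD mS (integrableD mS i1 i2) i3) i4).
Qed.

Lemma integrable_lin_integrand p : admissible p ->
  (time_prod P).-integrable (strip t T) (EFin \o lin_integrand p).
Proof.
move=> [p1 p2 _].
have dotA m (v : R -> 'cV[R]_m) (v' : @process d Omega R m) : L2_mx T v ->
    sq_process P t T v' -> (time_prod P).-integrable (strip t T)
      (EFin \o (fun x => dotmx (v x.1) (v' x.1 x.2))).
  move=> sv sv'; apply: integrable_dotmx => // j.
  exact: (L2_strip P (sv j 0) ht (lexx T)).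
exact: (integrableD mS (dotA _ q _ Lq p1) (dotA _ rho _ Lrho p2)).
Qed.

Lemma integrable_bilin_terminal p p' : admissible p -> admissible p' ->
  P.-integrable setT (EFin \o (fun w => dotmx (p'.1 T w) (G *m p.1 T w))).
Proof.
move=> [_ _ p3] [_ _ p3']; apply: integrable_dotmx => // i.
under eq_fun do rewrite mxE.
by apply: square_integrable_sum => // j; exact: square_integrableZ.
Qed.

Lemma integrable_lin_terminal p : admissible p ->
  P.-integrable setT (EFin \o (fun w => dotmx g (p.1 T w))).
Proof.
move=> [_ _ p3]; apply: integrable_dotmx => // j.
apply/square_integrableP; split => //.
by apply: measurable_bounded_integrable => //; exact: bounded_cst.
Qed.

Lemma bilin_cost_linl a p1 p2 p' : admissible p1 -> admissible p2 -> admissible p' ->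
  bilin_cost (pair_lin a p1 p2) p' = a * bilin_cost p1 p' + bilin_cost p2 p'.
Proof.
move=> a1 a2 a'.
have i1 := integrable_bilin_integrand a1 a'; have i2 := integrable_bilin_integrand a2 a'.
have j1 := integrable_bilin_terminal a1 a'; have j2 := integrable_bilin_terminal a2 a'.
rewrite /bilin_cost mulrDr -(RintegralZl a mS i1) -(RintegralZl a measurableT j1).
rewrite [RHS]addrACA -RintegralD//; last exact: (integrableZl mS a i1).
rewrite -RintegralD//; last exact: (integrableZl measurableT a j1).
congr (_ + _); apply: eq_Rintegral => x _.
  rewrite /bilin_integrand /running_bilin /= !mulmx_lin !dotmx_linr !dotmx_linl; ring.
by rewrite /= mulmx_lin dotmx_linr.
Qed.

Lemma lin_cost_lin a p1 p2 : admissible p1 -> admissible p2 ->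
  lin_cost (pair_lin a p1 p2) = a * lin_cost p1 + lin_cost p2.
Proof.
move=> a1 a2.
have i1 := integrable_lin_integrand a1; have i2 := integrable_lin_integrand a2.
have j1 := integrable_lin_terminal a1; have j2 := integrable_lin_terminal a2.
rewrite /lin_cost mulrDr -(RintegralZl a mS i1) -(RintegralZl a measurableT j1).
rewrite [RHS]addrACA -RintegralD//; last exact: (integrableZl mS a i1).
rewrite -RintegralD//; last exact: (integrableZl measurableT a j1).
congr (_ + _); apply: eq_Rintegral => x _.
  by rewrite /lin_integrand /running_lin /= !dotmx_linr; ring.
by rewrite /= dotmx_linr.
Qed.

Lemma bilin_costC p p' : bilin_cost p p' = bilin_cost p' p.
Proof.
rewrite /bilin_cost; congr (_ + _); apply: eq_Rintegral => x xD; last first.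
  by rewrite dotmx_mulr symG.
have xT : x.1 \in `[0, T].
  move: xD; rewrite inE => -[]; rewrite /= !in_itv/= => /andP[tx ->] _.
  by rewrite (le_trans ht tx).
rewrite /bilin_integrand /running_bilin.
rewrite (dotmx_mulr _ (Q x.1)) symQ// (dotmx_mulr _ (Rm x.1)) symR//; ring.
Qed.

Let strip_Rintegral_ext (f f' : measurableTypeR R * Omega -> R) :
  (time_prod P).-integrable (strip t T) (EFin \o f) ->
  (time_prod P).-integrable (strip t T) (EFin \o f') ->
  (forall s, s \in `[t, T] -> {ae P, forall w, f (s, w) = f' (s, w)}) ->
  \int[time_prod P]_(x in strip t T) f x = \int[time_prod P]_(x in strip t T) f' x.
Proof.
move=> fi fi' ff'; apply/eqP; rewrite -subr_eq0 -RintegralB//; apply/eqP.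
apply: strip_Rintegral_ae_eq0.
  apply: measurable_funB; apply/measurable_EFinP.
    exact: (measurable_int _ fi).
  exact: (measurable_int _ fi').
by move=> s /ff'; apply: filterS => w ->; rewrite subrr.
Qed.

Let Rintegral_ext (f f' : Omega -> R) :
  P.-integrable setT (EFin \o f) -> P.-integrable setT (EFin \o f') ->
  {ae P, forall w, f w = f' w} -> \int[P]_w f w = \int[P]_w f' w.
Proof.
move=> fi fi' ff'; rewrite /Rintegral; congr fine; apply: ae_eq_integral => //.
- exact: (measurable_int _ fi).
- exact: (measurable_int _ fi').
- by move: ff'; apply: filterS => w /= ->.
Qed.

Lemma bilin_cost_ext p1 p2 p' : admissible p1 -> admissible p2 -> admissible p' ->
  modification p1 p2 -> bilin_cost p1 p' = bilin_cost p2 p'.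
Proof.
move=> a1 a2 a' E; rewrite /bilin_cost; congr (_ + _).
  apply: strip_Rintegral_ext => [||s /E]; try exact: integrable_bilin_integrand.
  by apply: filterS => w; rewrite /bilin_integrand /= => -[-> ->].
apply: Rintegral_ext; try exact: integrable_bilin_terminal.
by move: (E T tIT); apply: filterS => w [-> _].
Qed.

Lemma lin_cost_ext p1 p2 : admissible p1 -> admissible p2 ->
  modification p1 p2 -> lin_cost p1 = lin_cost p2.
Proof.
move=> a1 a2 E; rewrite /lin_cost; congr (_ + _).
  apply: strip_Rintegral_ext => [||s /E]; try exact: integrable_lin_integrand.
  by apply: filterS => w; rewrite /lin_integrand /= => -[-> ->].
apply: Rintegral_ext; try exact: integrable_lin_terminal.
by move: (E T tIT); apply: filterS => w [-> _].
Qed.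

End quadratic_functional.

(** * Stacked controls *)

Section blocks.
Context {R : realType} {N : nat} {k : 'I_N -> nat}.
Implicit Type a : forall i, 'cV[R]_(k i).

Lemma stack_scale c a : stack (fun i => c *: a i) = c *: stack a.
Proof. by apply/matrixP => r j; rewrite !mxE. Qed.

Lemma sum_block_inj a : \sum_i block_inj i *m a i = stack a.
Proof.
apply/matrixP => r j; rewrite ord1 summxE /stack mxE {j}.
set i0 := tagnat.sig1 r; set b0 := tagnat.sig2 r.
rewrite (bigD1 i0)//= [X in _ + X]big1 ?addr0 => [|i i_neq].
  rewrite mxE (bigD1 b0)//= !mxE -/i0 -/b0 !eqxx mul1r big1 ?addr0// => b b_neq.
  by rewrite !mxE -/i0 -/b0 eqxx/= [_ == _ :> nat]eq_sym -val_eqE/= in b_neq *;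
    rewrite (negbTE b_neq) mul0r.
rewrite mxE big1// => b _; rewrite !mxE -/i0.
by rewrite eq_sym (negbTE i_neq) mul0r.
Qed.

Lemma stack_dfwith (d : measure_display) (Omega : measurableType d)
    (u : profile R k Omega) i (z : @process d Omega R (k i)) s w :
  stack (fun j => dfwith u i z j s w) =
  stack (fun j => u j s w) + block_inj i *m (z s w - u i s w).
Proof.
rewrite -!sum_block_inj [LHS](bigD1 i)//= [X in _ = X + _](bigD1 i)//= dfwithin mulmxBr.
rewrite [RHS]addrC addrA subrK; congr (_ + _); apply: eq_bigr => j j_neq.
by rewrite dfwithout// eq_sym.
Qed.

End blocks.

(** * Solutions paired with their inputs *)

Section solution_pairs.
Context {d : measure_display} {Omega : measurableType d} {R : realType}.
Context {n K dW : nat}.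
Variables (P : probability Omega R) (T t : R) (Flt : R -> set (set Omega)).
Variable W : 'I_dW -> R -> Omega -> R.
Hypotheses (hFlt : usual_filtration P T Flt) (hW : brownian_motion P T Flt W).
Hypotheses (ht : 0 <= t) (htT : t <= T).
Variables (A : R -> 'M[R]_n) (B : R -> 'M[R]_(n, K)) (b : R -> 'cV[R]_n).
Variables (C : 'I_dW -> R -> 'M[R]_n) (D : 'I_dW -> R -> 'M[R]_(n, K))
  (sigma : 'I_dW -> R -> 'cV[R]_n).
Hypotheses (LA : Linfty_mx T A) (LB : Linfty_mx T B) (Lb : L2_mx T b).
Hypotheses (LC : forall h, Linfty_mx T (C h)) (LD : forall h, Linfty_mx T (D h))
  (Lsigma : forall h, L2_mx T (sigma h)).
Implicit Types (z : 'cV[R]_n) (beta : R) (p : @path_pair d Omega R n K).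

(** A state together with the input that drives it; [beta] is the weight of the
    affine terms [b] and [sigma], so that solutions form a linear space. *)
Definition solution_pair z beta p : Prop :=
  sq_process P t T p.2 /\
  weak_solution P T t Flt W A B b C D sigma z beta p.2 p.1.

Lemma solution_pair_lin k z z' beta beta' p p' :
  solution_pair z beta p -> solution_pair z' beta' p' ->
  solution_pair (k *: z + z') (k * beta + beta') (pair_lin k p p').
Proof.
move=> [sU sol] [sU' sol']; split; first exact: sq_process_lin.
exact: (weak_solution_lin hFlt hW ht LA LB Lb LC LD Lsigma k sU sU' sol sol').
Qed.

Lemma eq_solution_pair z z' beta beta' p p' : solution_pair z beta p ->
  z = z' -> beta = beta' -> (forall s w, p.1 s w = p'.1 s w) ->
  (forall s w, p.2 s w = p'.2 s w) -> solution_pair z' beta' p'.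
Proof.
move=> sol <- <-; case: p p' sol => [Z U] [Z' U'] /= sol eZ eU.
suff [<- <-] : Z = Z' /\ U = U' by [].
by split; apply/funext => s; apply/funext => w; [exact: eZ|exact: eU].
Qed.

Lemma solution_pair_admissible z beta p : solution_pair z beta p -> admissible P T t p.
Proof.
move=> [sU sol]; split; [exact: sol.1|exact: sU|move=> j].
have TtT : T \in `[t, T] by rewrite in_itv/= htT lexx.
exact: (weak_solution_moment hFlt hW ht LA LB Lb LC LD Lsigma j sU sol TtT).1.
Qed.

Lemma solution_pair_unique z beta p p' : solution_pair z beta p ->
  solution_pair z beta p' -> (forall s w, p.2 s w = p'.2 s w) ->
  modification P T t p p'.
Proof.
move=> sol sol' eU s stT.
have sol0 : solution_pair 0 0
    (((fun s w => -1 *: p.1 s w + p'.1 s w), (fun _ _ => 0)) : path_pair).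
  apply: (eq_solution_pair (solution_pair_lin (-1) sol sol')) => //=.
  - by rewrite scaleN1r addNr.
  - by rewrite mulN1r addNr.
  - by move=> r w; rewrite eU scaleN1r addNr.
have := weak_solution_unique hFlt hW ht htT LA LB Lb LC LD Lsigma sol0.2 stT.
apply: filterS => w /= /eqP; rewrite scaleN1r addrC subr_eq0 => /eqP ->.
by rewrite eU.
Qed.

(** The zero solution is the difference of any solution with itself. *)
Lemma solution_pair0 z beta p : solution_pair z beta p ->
  solution_pair 0 0 ((fun _ _ => 0, fun _ _ => 0) : path_pair).
Proof.
move=> sol; apply: (eq_solution_pair (solution_pair_lin (-1) sol sol)) => /=.
- by rewrite scaleN1r addNr.
- by rewrite mulN1r addNr.
- by move=> s w; rewrite scaleN1r addNr.
- by move=> s w; rewrite scaleN1r addNr.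
Qed.

Lemma solution_pair_sum I (r : seq I) (f : I -> path_pair) :
  solution_pair 0 0 ((fun _ _ => 0, fun _ _ => 0) : path_pair) ->
  (forall i, solution_pair 0 0 (f i)) ->
  solution_pair 0 0 ((fun s w => \sum_(i <- r) (f i).1 s w,
                      fun s w => \sum_(i <- r) (f i).2 s w) : path_pair).
Proof.
move=> sol0 solf; elim: r => [|i r ih].
  by apply: (eq_solution_pair sol0) => //= s w; rewrite big_nil.
apply: (eq_solution_pair (solution_pair_lin 1 (solf i) ih)) => /=.
- by rewrite scale1r addr0.
- by rewrite mulr0 addr0.
- by move=> s w; rewrite big_cons scale1r.
- by move=> s w; rewrite big_cons scale1r.
Qed.

End solution_pairs.

(** * Convex combinations of controls *)

Section controls.
Context {d : measure_display} {Omega : measurableType d} {R : realType}.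
Context {N : nat} {k : 'I_N -> nat}.
Variables (P : probability Omega R) (T t : R) (Flt : R -> set (set Omega)).
Hypotheses (hFlt : usual_filtration P T Flt) (ht : 0 <= t) (htT : t <= T).
Variable act : forall i : 'I_N, set 'cV[R]_(k i).
Arguments act : clear implicits.
Hypothesis hconv : forall i,
  convex_set (act i : set (convex_lmodType 'cV[R]_(k i))).
Hypothesis hact0 : forall i, act i 0.

Lemma H2_lin m a (v v' : @process d Omega R m) : H2 P T Flt t v -> H2 P T Flt t v' ->
  H2 P T Flt t (fun s w => a *: v s w + v' s w).
Proof.
move=> Hv Hv'; have sq := sq_process_lin a (sq_process_of_H2 hFlt ht htT Hv)
  (sq_process_of_H2 hFlt ht htT Hv').
have [pv _] := Hv; have [pv' _] := Hv'; split.
  move=> s j st.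
  have := measurable_funD (measurable_funM (measurable_cst a) (pv s j st)) (pv' s j st).
  by apply: eq_measurable_fun => p _; rewrite !mxE.
set V := fun s w => _ in sq *.
have mV : measurable_fun (strip t T)
    (fun x : measurableTypeR R * Omega => \sum_(j < m) (V x.1 x.2 j 0) ^+ 2).
  by apply: measurable_sum => j; apply: measurable_funX; exact: (sq j).1.
have V0 (x : measurableTypeR R * Omega) : 0 <= \sum_(j < m) (V x.1 x.2 j 0) ^+ 2.
  by apply: sumr_ge0 => j _; exact: sqr_ge0.
rewrite [ltLHS](strip_tonelli P mV (fun x _ => V0 x)).1.
have mS := @measurable_strip _ Omega R t T.
have iV j : (time_prod P).-integrable (strip t T)
    (EFin \o (fun x => (V x.1 x.2 j 0) ^+ 2)).
  by have /square_integrableP[] := sq j.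
have iS := integrable_sum_real mS (index_enum 'I_m) iV.
by rewrite -EFin_Rintegral// ltry.
Qed.

Lemma H2_zero m : H2 P T Flt t (fun _ _ => 0 : 'cV[R]_m).
Proof.
split.
  move=> s j st; have := @measurable_cst _ _ (measurableTypeR R * g_sigma_algebraType (Flt s))%type
    R (`[t, s] `*` setT) 0.
  by apply: eq_measurable_fun => p _; rewrite mxE.
rewrite integral0_eq ?ltry// => w _; rewrite integral0_eq// => s _.
by rewrite big1// => j _; rewrite mxE expr0n.
Qed.

Lemma act_conv i (a c : 'cV[R]_(k i)) (e : R) : 0 <= e -> e <= 1 ->
  act i a -> act i c -> act i (a + e *: (c - a)).
Proof.
move=> e0 e1 Aa Ac.
have := hconv (Itv01 e0 e1) (mem_set Ac) (mem_set Aa).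
rewrite inE; congr (act i _).
rewrite /conv/= scalerBr /unstable.onem scalerBl scale1r addrC.
by rewrite -addrA; congr (_ + _); rewrite addrC.
Qed.

Lemma control0 i : control P T t Flt act ((fun _ _ => 0) : @process d Omega R (k i)).
Proof. by split => [|s w _]; [exact: H2_zero|exact: hact0]. Qed.

Lemma control_conv i (v v' : @process d Omega R (k i)) (e : R) : 0 <= e -> e <= 1 ->
  control P T t Flt act v -> control P T t Flt act v' ->
  control P T t Flt act (v + e *: (v' - v)).
Proof.
move=> e0 e1 [Hv Av] [Hv' Av']; split; last first.
  by move=> s w stT; apply: act_conv => //; [exact: Av|exact: Av'].
have := H2_lin e (H2_lin (-1) Hv Hv') Hv; congr (H2 P T Flt t).
apply/funext => s; apply/funext => w.
transitivity (v s w + e *: (v' s w - v s w)) => //.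
by rewrite scaleN1r [LHS]addrC [- _ + _]addrC.
Qed.

Lemma control_scale i (v : @process d Omega R (k i)) (r : R) : 0 <= r -> r <= 1 ->
  control P T t Flt act v -> control P T t Flt act (r *: v).
Proof.
move=> r0 r1 cv; have := control_conv r0 r1 (control0 i) cv.
by rewrite subr0 add0r.
Qed.

Lemma control_profile_dfwith (u : profile R k Omega) i (v : @process d Omega R (k i)) :
  control_profile P T t Flt act u -> control P T t Flt act v ->
  control_profile P T t Flt act (dfwith u i v).
Proof.
move=> cu cv j; have [<-|ij] := eqVneq i j; first by rewrite dfwithin.
by rewrite dfwithout.
Qed.

End controls.

(** * The potential of the linear-quadratic game *)

Section lq_potential.
Context {R : realType} {d : measure_display} {Omega : measurableType d}.
Context {N n dW : nat} {k : 'I_N -> nat}.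
Variables (P : probability Omega R) (T t : R) (Flt : R -> set (set Omega)).
Variable W : 'I_dW -> R -> Omega -> R.
Variable act : forall i : 'I_N, set 'cV[R]_(k i).
Arguments act : clear implicits.
Variables (c : lq_data R n dW k) (x : 'cV[R]_n).
Variable X : profile R k Omega -> @process d Omega R n.
Variable Y : forall i : 'I_N, @process d Omega R (k i) -> @process d Omega R n.
Arguments Y : clear implicits.
Variable dJ : forall i : 'I_N, profile R k Omega -> @process d Omega R (k i) -> R.
Arguments dJ : clear implicits.
Hypotheses (ht : 0 <= t) (htT : t <= T).
Hypothesis hFlt : usual_filtration P T Flt.
Hypothesis hW : brownian_motion P T Flt W.
Hypothesis hconv : forall i,
  convex_set (act i : set (convex_lmodType 'cV[R]_(k i))).
Hypothesis hact0 : forall i, act i 0.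
Hypothesis hc : lq_regular T c.
Hypothesis hX : forall u, control_profile P T t Flt act u ->
  state_equation P T t Flt W c x u (X u).
Hypothesis hY : forall i v, H2 P T Flt t v ->
  variational_equation P T t Flt W c v (Y i v).
Hypothesis hdJ : forall i,
  linear_derivative P T t Flt act (cost P T t c X i) (dJ i).

Local Notation K := (\sum_(i < N) k i)%N.
Local Notation pairT := (@path_pair d Omega R n K).
Local Notation is_control i v := (control P T t Flt act (i := i) v).
Local Notation is_profile u := (control_profile P T t Flt act u).
Local Notation sol := (solution_pair P T t Flt W
  (lqA c) (lqB c) (lqb c) (lqC c) (lqD c) (lqsigma c)).
Local Notation adm := (admissible P T t).
Local Notation BB i := (bilin_cost P T t (lqQ c i) (lqR c i) (lqS c i) (lqG c i)).
Local Notation LL i := (lin_cost P T t (lqq c i) (lqrho c i) (lqg c i)).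

Let LA := lqA_Linfty hc.
Let LB := lqB_Linfty hc.
Let Lb := lqb_L2 hc.
Let LC := lqC_Linfty hc.
Let LD := lqD_Linfty hc.
Let Ls := lqsigma_L2 hc.

Definition state_pair (u : profile R k Omega) : pairT :=
  (X u, fun s w => stack (fun i => u i s w)).

Definition variation_pair i (v : @process d Omega R (k i)) : pairT :=
  (Y i v, fun s w => block_inj i *m v s w).

Lemma sq_process_stack (u : profile R k Omega) :
  (forall i, sq_process P t T (u i)) ->
  sq_process P t T (fun s w => stack (fun i => u i s w)).
Proof. by move=> su r; under eq_fun do rewrite mxE; exact: su. Qed.

Lemma sq_process_block_inj i (v : @process d Omega R (k i)) :
  sq_process P t T v -> sq_process P t T (fun s w => block_inj i *m v s w).
Proof.
move=> sv r; under eq_fun do rewrite mxE.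
apply: square_integrable_sum => [|j]; first exact: measurable_strip.
by apply: square_integrableZ => //; exact: measurable_strip.
Qed.

Lemma state_solution u : is_profile u -> sol x 1 (state_pair u).
Proof.
move=> cu; have sU : sq_process P t T (state_pair u).2.
  by apply: sq_process_stack => i; exact: (sq_process_of_H2 hFlt ht htT (cu i).1).
split => //; apply: (weak_solution_of_sde hFlt ht htT LC LD Ls sU _ _ (hX cu)).
- by move=> s w; rewrite /lin_field scale1r.
- by move=> h s w; rewrite /lin_field scale1r.
Qed.

Lemma variation_solution i (v : @process d Omega R (k i)) :
  H2 P T Flt t v -> sol 0 0 (variation_pair v).
Proof.
move=> Hv; have sU : sq_process P t T (variation_pair v).2.
  exact: sq_process_block_inj (sq_process_of_H2 hFlt ht htT Hv).
split => //; apply: (weak_solution_of_sde hFlt ht htT LC LD Ls sU _ _ (hY Hv)).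
- by move=> s w; rewrite /lin_field scale0r addr0 mulmxA.
- by move=> h s w; rewrite /lin_field scale0r addr0 mulmxA.
Qed.

Let sol_lin := solution_pair_lin hFlt hW ht LA LB Lb LC LD Ls.
Let sol_adm := solution_pair_admissible hFlt hW ht htT LA LB Lb LC LD Ls.
Let sol_unique := solution_pair_unique hFlt hW ht htT LA LB Lb LC LD Ls.

Let BBC i (p p' : pairT) : BB i p p' = BB i p' p.
Proof.
apply: bilin_costC => //; [exact: (lqQ_sym hc)|exact: (lqR_sym hc)|exact: (lqG_sym hc)].
Qed.

Let BB_linl i a (p1 p2 p' : pairT) : adm p1 -> adm p2 -> adm p' ->
  BB i (pair_lin a p1 p2) p' = a * BB i p1 p' + BB i p2 p'.
Proof.
by apply: bilin_cost_linl => //; [exact: (lqQ_Linfty hc)|exact: (lqR_Linfty hc)|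
  exact: (lqS_Linfty hc)].
Qed.

Let BB_linr i a (p1 p2 p' : pairT) : adm p1 -> adm p2 -> adm p' ->
  BB i p' (pair_lin a p1 p2) = a * BB i p' p1 + BB i p' p2.
Proof. by move=> a1 a2 a'; rewrite BBC BB_linl// !(BBC i p'). Qed.

Let BB_ext i (p1 p2 p' : pairT) : adm p1 -> adm p2 -> adm p' ->
  modification P T t p1 p2 -> BB i p1 p' = BB i p2 p'.
Proof.
by apply: bilin_cost_ext => //; [exact: (lqQ_Linfty hc)|exact: (lqR_Linfty hc)|
  exact: (lqS_Linfty hc)].
Qed.

Let LL_lin i a (p1 p2 : pairT) : adm p1 -> adm p2 ->
  LL i (pair_lin a p1 p2) = a * LL i p1 + LL i p2.
Proof.
by apply: lin_cost_lin => //; [exact: (lqq_L2 hc)|exact: (lqrho_L2 hc)].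
Qed.

Let LL_ext i (p1 p2 : pairT) : adm p1 -> adm p2 ->
  modification P T t p1 p2 -> LL i p1 = LL i p2.
Proof.
by apply: lin_cost_ext => //; [exact: (lqq_L2 hc)|exact: (lqrho_L2 hc)].
Qed.

Let iB i p p' : adm p -> adm p' -> (time_prod P).-integrable (strip t T)
  (EFin \o bilin_integrand (lqQ c i) (lqR c i) (lqS c i) p p').
Proof.
by apply: integrable_bilin_integrand => //; [exact: (lqQ_Linfty hc)|
  exact: (lqR_Linfty hc)|exact: (lqS_Linfty hc)].
Qed.

Let iL i p : adm p -> (time_prod P).-integrable (strip t T)
  (EFin \o lin_integrand (lqq c i) (lqrho c i) p).
Proof.
by apply: integrable_lin_integrand => //; [exact: (lqq_L2 hc)|exact: (lqrho_L2 hc)].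
Qed.

Lemma cost_quadratic i u : is_profile u ->
  cost P T t c X i u =
    2^-1 * BB i (state_pair u) (state_pair u) + LL i (state_pair u).
Proof.
move=> cu; have ap := sol_adm (state_solution cu); set p := state_pair u in ap *.
have mS := @measurable_strip _ Omega R t T.
have i1 := iB i ap ap; have i2 := iL i ap; have i3 := integrableZl mS 2 i2.
have j1 := integrable_bilin_terminal (lqG c i) ap ap.
have j2 := integrable_lin_terminal (lqg c i) ap.
have j3 := integrableZl measurableT 2 j2.
have fi := integrableD mS i1 i3; have ki := integrableD measurableT j1 j3.
have [_ E] := Rintegral_running_terminal fi ki.
rewrite /cost unlock /=.
transitivity (2^-1 * \int[P]_w (\int[lebesgue_measure]_(s in `[t, T])
    (bilin_integrand (lqQ c i) (lqR c i) (lqS c i) p p (s, w) +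
     2 * lin_integrand (lqq c i) (lqrho c i) p (s, w)) +
    (dotmx (p.1 T w) (lqG c i *m p.1 T w) + 2 * dotmx (lqg c i) (p.1 T w)))).
  congr (_ * _); apply: eq_Rintegral => w _; rewrite -addrA; congr (_ + _).
  apply: eq_Rintegral => s _.
  by rewrite /bilin_integrand /lin_integrand /running_bilin /running_lin /=; ring.
rewrite E (RintegralD mS i1 i3) (RintegralD measurableT j1 j3).
rewrite (RintegralZl 2 mS i2) (RintegralZl 2 measurableT j2).
by rewrite /bilin_cost /lin_cost; field.
Qed.

(** The state is affine in the control, so the cost along a segment of controls
    is a quadratic polynomial, whose slope at 0 is the linear derivative. *)
Lemma linear_derivativeE i u v : is_profile u -> is_control i v ->
  dJ i u (v - u i) =
    BB i (pair_lin (-1) (variation_pair (u i)) (variation_pair v)) (state_pair u) +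
    LL i (pair_lin (-1) (variation_pair (u i)) (variation_pair v)).
Proof.
move=> cu cv; set p := state_pair u.
set q := pair_lin (-1) (variation_pair (u i)) (variation_pair v).
have solp := state_solution cu; have ap := sol_adm solp.
have solq := sol_lin (-1) (variation_solution (cu i).1) (variation_solution cv.1).
have aq : adm q := sol_adm solq.
have costE e : 0 <= e -> e <= 1 ->
    cost P T t c X i (dfwith u i (u i + e *: (v - u i))) =
    cost P T t c X i u + e * (BB i q p + LL i q) + e ^+ 2 * (2^-1 * BB i q q).
  move=> e0 e1; set u' := dfwith _ _ _.
  have cu' : is_profile u'.
    by apply: control_profile_dfwith => //; exact: control_conv.
  have solp' := state_solution cu'; have ap' := sol_adm solp'.
  have solr := sol_lin e solq solp; have ar := sol_adm solr.
  set r := pair_lin e q p in solr ar.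
  have indp : modification P T t (state_pair u') r.
    apply: (sol_unique solp'); last first.
      move=> s w; rewrite /state_pair /r /q /=.
      rewrite stack_dfwith [LHS]addrC; congr (_ + _).
      transitivity (block_inj i *m (u i s w + e *: (v s w - u i s w) - u i s w)) => //.
      by rewrite addrC addKr -scalemxAr mulmxBr scaleN1r [- _ + _]addrC.
    apply: (eq_solution_pair solr) => //.
    - by rewrite scaler0 addr0 scaler0 add0r.
    - by rewrite mulr0 addr0 mulr0 add0r.
  rewrite !cost_quadratic// (BB_ext i ap' ar ap' indp) BBC (BB_ext i ap' ar ar indp).
  rewrite (LL_ext i ap' ar indp) /r (BB_linl i e aq ap ar).
  rewrite (BB_linr i e aq ap aq) (BB_linr i e aq ap ap) (LL_lin i e aq ap) (BBC i p q) -/p.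
  by field.
have [_ dlim] := hdJ i; have := dlim u v cu cv.
set L := BB i q p + LL i q in costE *; set m := 2^-1 * BB i q q in costE.
have lim_poly : (fun e : R => e^-1 * (cost P T t c X i (dfwith u i (u i + e *: (v - u i)))
    - cost P T t c X i u)) @ 0^'+ --> L.
  have poly : (L + e * m) @[e --> 0^'+] --> L.
    apply: cvg_at_right_filter; rewrite -[X in _ --> X]addr0 -[X in _ --> _ + X](mul0r m).
    by apply: cvgD; [exact: cvg_cst|apply: cvgM; [exact: cvg_id|exact: cvg_cst]].
  apply: cvg_trans poly; apply: near_eq_cvg; near=> e.
  have e0 : 0 < e by [].
  have e1 : e <= 1 by near: e; exact: nbhs_right_le.
  by rewrite costE ?ltW//; field; rewrite gt_eqF.
by move=> lim_dJ; apply: (cvg_unique _ lim_dJ lim_poly).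
Unshelve. all: by end_near. Qed.

(** Directions of differentiation have the form [v - r u_i] with [v] a control:
    [u_i] is the difference of those for [v = u_i] and [v = 0].  This also covers
    [r = 1], where [v = u_i] gives the zero direction. *)
Lemma linear_derivative_scaled i u r : is_profile u -> 0 <= r -> r <= 1 ->
  dJ i (fun j => r *: u j) (u i) =
    BB i (state_pair (fun j => r *: u j)) (variation_pair (u i)) +
    LL i (variation_pair (u i)).
Proof.
move=> cu r0 r1; set ru := fun j => r *: u j.
have cru : is_profile ru by move=> j; exact: control_scale.
have c0 := @control0 d Omega R N k P T t Flt act hact0 i.
pose z0 : @process d Omega R (k i) := 0.
have cz0 : is_control i z0 by [].
have span v : is_control i v -> lin_span [set w | is_control i w] (v - ru i).
  move=> cv; exists 2%N.
  exists (fun j => if j == ord0 then 1 else -1).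
  exists (fun j => if j == ord0 then v else ru i); split.
    by move=> j; case: ifP => _ //; exact: cru.
  by rewrite big_ord_recl big_ord1 /= scale1r scaleN1r.
have [dlin _] := hdJ i.
have uE : u i = -1 *: (z0 - ru i) + (u i - ru i).
  by rewrite scaleN1r opprB /z0 subr0 addrC subrK.
rewrite {1}uE (dlin ru cru (-1) (z0 - ru i) (u i - ru i) (span _ cz0) (span _ (cu i))).
rewrite !linear_derivativeE//.
set p := state_pair ru; set pu := variation_pair (u i).
set pr := variation_pair (ru i); set pz := variation_pair z0.
have ap : adm p := sol_adm (state_solution cru).
have apu : adm pu := sol_adm (variation_solution (cu i).1).
have apr : adm pr := sol_adm (variation_solution (cru i).1).
have solz : sol 0 0 pz := variation_solution cz0.1.
have apz : adm pz := sol_adm solz.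
have solz0 := solution_pair0 hFlt hW ht LA LB Lb LC LD Ls solz.
have az0 := sol_adm solz0.
have indz : modification P T t pz ((fun _ _ => 0, fun _ _ => 0) : pairT).
  by apply: sol_unique solz solz0 _ => s w /=; rewrite mulmx0.
have ext0 : pair_lin (-1) pz pz = ((fun _ _ => 0, fun _ _ => 0) : pairT).
  by congr pair; apply/funext => s; apply/funext => w /=; rewrite scaleN1r addNr.
have B0 : BB i pz p = 0.
  by rewrite (BB_ext i apz az0 ap indz) -ext0 BB_linl// mulN1r addNr.
have L0 : LL i pz = 0.
  by rewrite (LL_ext i apz az0 indz) -ext0 LL_lin// mulN1r addNr.
rewrite !BB_linl// !LL_lin// B0 L0 (BBC i p pu); ring.
Qed.

(** The derivative at [r u] is affine in [1 - r], whose mean over [0, 1] is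
    one half. *)
Lemma alpha_potentialE u : is_profile u ->
  alpha_potential dJ u = \sum_i
    (BB i (pair_lin (- 2^-1)
       (fun s w => \sum_j Y j (u j) s w, fun s w => stack (fun j => u j s w))
       (state_pair u)) (variation_pair (u i)) + LL i (variation_pair (u i))).
Proof.
move=> cu; have solp := state_solution cu; have ap := sol_adm solp.
set p := state_pair u in solp ap *.
set pbar : pairT := (fun s w => \sum_j Y j (u j) s w, _).
have sol0 := solution_pair0 hFlt hW ht LA LB Lb LC LD Ls solp.
have solv j := variation_solution (cu j).1.
have av j : adm (variation_pair (u j)) := sol_adm (solv j).
have solbar : sol 0 0 pbar.
  apply: (eq_solution_pair (solution_pair_sum hFlt hW ht LA LB Lb LC LD Ls
    (index_enum 'I_N) sol0 solv)) => //= s w.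
  exact: sum_block_inj.
have abar : adm pbar := sol_adm solbar.
pose al := \sum_i (BB i p (variation_pair (u i)) + LL i (variation_pair (u i))).
pose be := \sum_i BB i pbar (variation_pair (u i)).
transitivity (al - 2^-1 * be); last first.
  rewrite /al /be mulr_sumr -sumrB; apply: eq_bigr => i _.
  by rewrite BB_linl//; ring.
have dJE r : r \in `[0, 1] ->
    \sum_i dJ i (fun j => r *: u j) (u i) = al + - be * (1 - r) ^+ 1.
  rewrite in_itv/= => /andP[r0 r1].
  have cru : is_profile (fun j => r *: u j) by move=> j; exact: control_scale.
  have solr := state_solution cru; have ar := sol_adm solr.
  have sols := sol_lin (r - 1) solbar solp; have as_ := sol_adm sols.
  have ind : modification P T t (state_pair (fun j => r *: u j))
      (pair_lin (r - 1) pbar p).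
    apply: (sol_unique solr).
      apply: (eq_solution_pair sols) => //.
      - by rewrite scaler0 add0r.
      - by rewrite mulr0 add0r.
    move=> s w /=; rewrite -[RHS]scale1r.
    rewrite (stack_scale r (fun j => u j s w)) scale1r scalerBl scale1r.
    by rewrite subrK.
  transitivity (al + (r - 1) * be); last by rewrite expr1; ring.
  rewrite /al /be mulr_sumr -big_split; apply: eq_bigr => i _ /=.
  rewrite linear_derivative_scaled// (BB_ext i ar as_ (av i) ind) BB_linl//; ring.
rewrite /alpha_potential.
transitivity (\int[lebesgue_measure]_(r in `[0, 1]) (al + - be * (1 - r) ^+ 1)).
  by apply: eq_Rintegral => r; rewrite inE => r01; exact: dJE.
have m01 : measurable (`[0, 1] : set (measurableTypeR R)) by exact: measurable_itv.
have len01 : (@lebesgue_measure R) (`[0%R, 1%R] : set R) = 1%E.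
  by rewrite lebesgue_measure_itv/= lte01 oppr0 adde0.
have fin01 : ((@lebesgue_measure R) (`[0%R, 1%R] : set R) < +oo)%E by rewrite len01 ltry.
have ical : (@lebesgue_measure R).-integrable `[0, 1] (EFin \o (fun=> al)).
  by apply: measurable_bounded_integrable => //; exact: bounded_cst.
have iom : (@lebesgue_measure R).-integrable `[0, 1] (EFin \o (fun r => (1 - r) ^+ 1)).
  apply: continuous_compact_integrable; first exact: segment_compact.
  by apply: continuous_subspaceT => r; exact: continuous_onemXn.
rewrite RintegralD//; last exact: (integrableZl m01 (- be) iom).
rewrite Rintegral_cst// (RintegralZl (- be) m01 iom) Rintegral_onemXn.
by rewrite [X in fine X](len01 : _ = _) mulr1 mulNr mulrC.
Qed.

(** The pair formed by [x - ybar / 2] and half of the control. *)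
Let potential_pair u : pairT :=
  pair_lin (- 2^-1)
    (fun s w => \sum_j Y j (u j) s w, fun s w => stack (fun j => u j s w))
    (state_pair u).

Lemma potential_runningE u s w :
  potential_running c s (X u s w) (fun i => Y i (u i) s w) (fun i => u i s w) =
  \sum_i (bilin_integrand (lqQ c i) (lqR c i) (lqS c i)
             (potential_pair u) (variation_pair (u i)) (s, w) +
           lin_integrand (lqq c i) (lqrho c i) (variation_pair (u i)) (s, w)).
Proof.
apply: eq_bigr => i _.
rewrite /bilin_integrand /lin_integrand /running_bilin /running_lin /=.
set ybar := \sum_j _; set v := stack _; set y := Y i (u i) s w; set e := block_inj i *m _.
have -> : - 2^-1 *: ybar + X u s w = X u s w - 2^-1 *: ybar by rewrite scaleNr addrC.
have -> : - 2^-1 *: v + v = 2^-1 *: v.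
  by rewrite -[X in _ + X]scale1r -scalerDl; congr (_ *: _); field.
rewrite -!scalemxAr !dotmxDr !dotmxZr (dotmx_mulr (X u s w - _) _ e) (dotmxC e (lqrho c i s)).
ring.
Qed.

Lemma potential_terminalE u w :
  potential_terminal c (X u T w) (fun i => Y i (u i) T w) =
  \sum_i (dotmx ((variation_pair (u i)).1 T w) (lqG c i *m (potential_pair u).1 T w) +
           dotmx (lqg c i) ((variation_pair (u i)).1 T w)).
Proof.
by apply: eq_bigr => i _ /=; rewrite scaleNr (addrC (- (2^-1 *: _)) (X u T w)).
Qed.

Lemma potential_mean u : is_profile u ->
  'E_P[fun w =>
      (\int[lebesgue_measure]_(s in `[t, T])
         potential_running c s (X u s w) (fun i => Y i (u i) s w)
           (fun i => u i s w)
       + potential_terminal c (X u T w) (fun i => Y i (u i) T w))%R]%E =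
  (\sum_i (BB i (potential_pair u) (variation_pair (u i)) +
            LL i (variation_pair (u i))))%:E.
Proof.
move=> cu; have av i : adm (variation_pair (u i)) := sol_adm (variation_solution (cu i).1).
have solp := state_solution cu.
have sol0 := solution_pair0 hFlt hW ht LA LB Lb LC LD Ls solp.
have solbar := solution_pair_sum hFlt hW ht LA LB Lb LC LD Ls (index_enum 'I_N) sol0
  (fun i => variation_solution (cu i).1).
have app : adm (potential_pair u).
  apply: admissible_lin (sol_adm solp); have [a1 a2 a3] := sol_adm solbar.
  split => //= r; move: (a2 r) => /=.
  by under [X in square_integrable _ _ X]eq_fun do rewrite sum_block_inj.
have mS := @measurable_strip _ Omega R t T.
have fi i := integrableD mS (iB i app (av i)) (iL i (av i)).
have ki i := integrableD measurableT (integrable_bilin_terminal (lqG c i) app (av i))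
  (integrable_lin_terminal (lqg c i) (av i)).
have sfi := integrable_sum_real mS (index_enum 'I_N) fi.
have ski := integrable_sum_real measurableT (index_enum 'I_N) ki.
have [itot Etot] := Rintegral_running_terminal sfi ski.
have fE w : \int[lebesgue_measure]_(s in `[t, T])
       potential_running c s (X u s w) (fun i => Y i (u i) s w) (fun i => u i s w)
     + potential_terminal c (X u T w) (fun i => Y i (u i) T w) =
   \int[lebesgue_measure]_(s in `[t, T]) (\sum_i
      (bilin_integrand (lqQ c i) (lqR c i) (lqS c i)
             (potential_pair u) (variation_pair (u i)) (s, w) +
           lin_integrand (lqq c i) (lqrho c i) (variation_pair (u i)) (s, w))) +
   \sum_i (dotmx ((variation_pair (u i)).1 T w) (lqG c i *m (potential_pair u).1 T w) +
           dotmx (lqg c i) ((variation_pair (u i)).1 T w)).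
  rewrite potential_terminalE; congr (_ + _).
  by apply: eq_Rintegral => s _; exact: potential_runningE.
rewrite unlock; under eq_integral do rewrite fE.
rewrite -(EFin_Rintegral measurableT itot) Etot; congr EFin.
rewrite (Rintegral_sum mS _ fi) (Rintegral_sum measurableT _ ki) -big_split.
apply: eq_bigr => i _ /=; rewrite (RintegralD mS (iB i app (av i)) (iL i (av i))).
rewrite (RintegralD measurableT (integrable_bilin_terminal (lqG c i) app (av i))
  (integrable_lin_terminal (lqg c i) (av i))).
by rewrite addrACA.
Qed.

End lq_potential.

Theorem proposition4p1 (R : realType) (d : measure_display)
    (Omega : measurableType d) (P : probability Omega R)
    (N n dW : nat) (k : 'I_N -> nat) (T t : R)
    (Flt : R -> set (set Omega)) (W : 'I_dW -> R -> Omega -> R)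
    (act : forall i : 'I_N, set 'cV[R]_(k i))
    (c : lq_data R n dW k) (x : 'cV[R]_n)
    (X : profile R k Omega -> @process d Omega R n)
    (Y : forall i : 'I_N, @process d Omega R (k i) -> @process d Omega R n)
    (dJ : forall i : 'I_N, profile R k Omega -> @process d Omega R (k i) -> R)
    (ht : 0 <= t) (htT : t <= T)
    (hP : measure_is_complete P)
    (hFlt : usual_filtration P T Flt)
    (hW : brownian_motion P T Flt W)
    (hconv : forall i,
       convex_set (act i : set (convex_lmodType 'cV[R]_(k i))))
    (hact0 : forall i, act i 0)
    (hc : lq_regular T c)
    (hX : forall u, control_profile P T t Flt act u ->
       state_equation P T t Flt W c x u (X u))
    (hY : forall i v, H2 P T Flt t v ->
       variational_equation P T t Flt W c v (Y i v))
    (hdJ : forall i,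
       linear_derivative P T t Flt act (cost P T t c X i) (dJ i)) :
  forall u, control_profile P T t Flt act u ->
    (alpha_potential dJ u)%:E =
    'E_P[fun w =>
      (\int[lebesgue_measure]_(s in `[t, T])
         potential_running c s (X u s w) (fun i => Y i (u i) s w)
           (fun i => u i s w)
       + potential_terminal c (X u T w) (fun i => Y i (u i) T w))%R]%E.
Proof.
move=> u cu.
rewrite (alpha_potentialE ht htT hFlt hW hconv hact0 hc hX hY hdJ cu).
by rewrite (potential_mean ht htT hFlt hW hc hX hY cu).
Qed.
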